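(* Let $\mathcal{M}$ be a compact embedded Riemannian submanifold of $\mathbb{R}^n$ with $\dim(\mathcal{M})=d$, let $1\le k<d$, and let $f:\mathbb{R}^n\to\mathbb{R}$ be smooth. Consider the constrained saddle dynamic $$\frac{\mathrm{d}\mathbf{x}}{\mathrm{d}t}(t)=-R_{\mathbf{x}(t),P(t)}\big(\mathrm{grad}_{\mathcal{M}}f(\mathbf{x}(t))\big),$$ $$\frac{\mathrm{d}P}{\mathrm{d}t}(t)=-\big[P(t),[P(t),\mathrm{Hess}_{\mathcal{M}}f(\mathbf{x}(t))]\big]+\widehat{\mathrm{II}}_{\mathbf{x}(t)}\Big(\frac{\mathrm{d}\mathbf{x}}{\mathrm{d}t}(t),P(t)\Big).$$ If $(\mathbf{x}(0),P(0))\in\mathrm{Gr}_k(\mathrm{T}\mathcal{M})$, then the dynamic is globally well defined and its trajectory always stays on the Grassmann bundle: the solution $(\mathbf{x}(t),P(t))$ exists for all times $t\ge 0$ and $(\mathbf{x}(t),P(t))\in\mathrm{Gr}_k(\mathrm{T}\mathcal{M})$ for all $t\ge0$.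
   Context: $\mathcal{M}\subset\mathbb{R}^n$ carries the metric induced by the Euclidean inner product; $\mathrm{T}_{\mathbf{x}}\mathcal{M}$ is the tangent space and $\mathrm{Proj}_{\mathrm{T}_{\mathbf{x}}\mathcal{M}}$ the orthogonal projector of $\mathbb{R}^n$ onto it. Grassmann bundle: $\mathrm{Gr}_k(\mathrm{T}\mathcal{M}):=\{(\mathbf{x},P)\mid \mathbf{x}\in\mathcal{M},\ P\in\mathrm{Gr}_k(\mathrm{T}_{\mathbf{x}}\mathcal{M})\}$, where $\mathrm{Gr}_k(\mathrm{T}_{\mathbf{x}}\mathcal{M})$ is the set of $k$-dimensional linear subspaces of $\mathrm{T}_{\mathbf{x}}\mathcal{M}$, each identified with the orthogonal projector onto it, i.e. with $P\in\mathbb{R}^{n\times n}$, $P^\top=P$, $P^2=P$, $\mathrm{rank}(P)=k$, $\mathrm{Ran}(P)\subseteq\mathrm{T}_{\mathbf{x}}\mathcal{M}$. Thus $\mathrm{Gr}_k(\mathrm{T}\mathcal{M})\subset\mathbb{R}^n\times\mathbb{R}^{n\times n}_{\mathrm{sym}}$. Second fundamental form: $\mathrm{II}_{\mathbf{x}}(\mathbf{u},\mathbf{v}):=\mathrm{D}(\mathbf{y}\mapsto\mathrm{Proj}_{\mathrm{T}_{\mathbf{y}}\mathcal{M}})(\mathbf{x})[\mathbf{u}](\mathbf{v})$, which lies in the normal space, for $\mathbf{u},\mathbf{v}\in\mathrm{T}_{\mathbf{x}}\mathcal{M}$. For $\mathbf{u}\in\mathrm{T}_{\mathbf{x}}\mathcal{M}$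 and $Q=\sum_{\ell=1}^k\mathbf{u}_\ell\mathbf{u}_\ell^\top\in\mathrm{Gr}_k(\mathrm{T}_{\mathbf{x}}\mathcal{M})$ with $\mathbf{u}_1,\dots,\mathbf{u}_k$ orthonormal in $\mathrm{T}_{\mathbf{x}}\mathcal{M}$, $$\widehat{\mathrm{II}}_{\mathbf{x}}(\mathbf{u},Q):=\sum_{\ell=1}^k\mathrm{II}_{\mathbf{x}}(\mathbf{u},\mathbf{u}_\ell)\mathbf{u}_\ell^\top+\sum_{\ell=1}^k\mathbf{u}_\ell\,\mathrm{II}_{\mathbf{x}}(\mathbf{u},\mathbf{u}_\ell)^\top$$ (independent of the chosen orthonormal basis). Reflection: $R_{\mathbf{x},P}(\mathbf{u}):=\mathbf{u}-2P\mathbf{u}$ for $\mathbf{u}\in\mathrm{T}_{\mathbf{x}}\mathcal{M}$. Commutator: $[A,B]:=AB-BA$. $\mathrm{grad}_{\mathcal{M}}f$ and $\mathrm{Hess}_{\mathcal{M}}f$ are the Riemannian gradient and Hessian; $\mathrm{Hess}_{\mathcal{M}}f(\mathbf{x})$ is regarded as a symmetric $n\times n$ matrix by extending it by zero on the normal space. The map $M\mapsto[P,[P,M]]$ is the orthogonal projection onto the tangent space at $P$ of $\mathrm{Gr}_k(\mathrm{T}_{\mathbf{x}}\mathcal{M})$. *)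

(* Defs.v *)
From mathcomp Require Import all_boot all_order all_algebra.
From mathcomp Require Import all_classical all_reals all_analysis.
Set Implicit Arguments.
Unset Strict Implicit.
Unset Printing Implicit Defensive.
Import Order.TTheory GRing.Theory Num.Theory.
Import numFieldNormedType.Exports.
Local Open Scope classical_set_scope.
Local Open Scope ring_scope.

(* All spaces below are finite dimensional, so C^(r+1) on an open set means:
   differentiable there, with every v-component of the differential C^r. *)
Fixpoint Cr_on {R : realType} {V W : normedModType R}
    (r : nat) (U : set V) (f : V -> W) : Prop :=
  if r is r'.+1 then
    (forall x, U x -> differentiable f x) /\
    (forall v : V, Cr_on r' U (fun x => 'd f x v))
  else forall x, U x -> {for x, continuous f}.

Definition smooth_on {R : realType} {V W : normedModType R}
    (U : set V) (f : V -> W) : Prop :=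
  forall r : nat, Cr_on r U f.

(* The topology of 'cV[R]_n is that of the max norm, hence the Euclidean one. *)
Definition dot {R : realType} {n : nat} (u v : 'cV[R]_n) : R :=
  (u^T *m v) 0 0.

(* Local slice condition: near each of its points, M is straightened by a
   diffeomorphism phi : U -> phi(U) of open sets, with inverse psi, to the
   coordinate subspace where the coordinates of index >= d vanish. *)
Definition embedded_submanifold {R : realType} {n : nat} (d : nat)
    (M : set 'cV[R]_n) : Prop :=
  (d <= n)%N /\
  forall x, M x -> exists (U : set 'cV[R]_n) (phi psi : 'cV[R]_n -> 'cV[R]_n),
    [/\ open U /\ U x,
        smooth_on U phi,
        open (phi @` U) /\ smooth_on (phi @` U) psi,
        forall y, U y -> psi (phi y) = y &
        forall y, U y ->
          (M y <-> forall i : 'I_n, (d <= i)%N -> phi y i 0 = 0)].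

Definition curve_through {R : realType} {n : nat} (M : set 'cV[R]_n)
    (x u : 'cV[R]_n) (c : R -> 'cV[R]_n) : Prop :=
  [/\ exists2 e : R, 0 < e &
        smooth_on (ball (0 : R) e) c /\ (forall t, ball (0 : R) e t -> M (c t)),
      c 0 = x & is_derive (0 : R) (1 : R) c u].

Definition tangent {R : realType} {n : nat} (M : set 'cV[R]_n)
    (x : 'cV[R]_n) : set 'cV[R]_n :=
  [set u | exists c, curve_through M x u c].

Definition orth_projector {R : realType} {n : nat} (S : set 'cV[R]_n)
    (P : 'M[R]_n) : Prop :=
  [/\ P^T = P, P *m P = P & range (fun v : 'cV[R]_n => P *m v) = S].

Definition tproj {R : realType} {n : nat} (M : set 'cV[R]_n)
    (x : 'cV[R]_n) : 'M[R]_n :=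
  get [set P | orth_projector (tangent M x) P].

(* Differential at x, along the tangent vector u, of a map that only matters
   on M: the common derivative of F along the curves of M with velocity u. *)
Definition mdiff {R : realType} {n : nat} {W : normedModType R}
    (M : set 'cV[R]_n) (F : 'cV[R]_n -> W) (x u : 'cV[R]_n) : W :=
  get [set w | forall c, curve_through M x u c ->
                 is_derive (0 : R) (1 : R) (F \o c) w].

Definition rgrad {R : realType} {n : nat} (M : set 'cV[R]_n)
    (f : 'cV[R]_n -> R) (x : 'cV[R]_n) : 'cV[R]_n :=
  get [set g | tangent M x g /\
               forall v, tangent M x v -> dot g v = mdiff M f x v].

(* The Levi-Civita connection of the induced metric is the tangential
   projection of the Euclidean derivative. *)
Definition rhess_op {R : realType} {n : nat} (M : set 'cV[R]_n)
    (f : 'cV[R]_n -> R) (x u : 'cV[R]_n) : 'cV[R]_n :=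
  tproj M x *m mdiff M (rgrad M f) x u.

(* Matrix of rhess_op extended by zero on the normal space: column j is the
   value at the tangential part of the j-th basis vector. *)
Definition rhess {R : realType} {n : nat} (M : set 'cV[R]_n)
    (f : 'cV[R]_n -> R) (x : 'cV[R]_n) : 'M[R]_n :=
  \matrix_(i, j) rhess_op M f x (tproj M x *m delta_mx j 0) i 0.

Definition grassmann_bundle {R : realType} {n : nat} (k : nat)
    (M : set 'cV[R]_n) : set ('cV[R]_n * 'M[R]_n) :=
  [set z | M z.1 /\
    [/\ z.2^T = z.2, z.2 *m z.2 = z.2, \rank z.2 = k &
        range (fun v : 'cV[R]_n => z.2 *m v) `<=` tangent M z.1]].

Definition sff {R : realType} {n : nat} (M : set 'cV[R]_n)
    (x u v : 'cV[R]_n) : 'cV[R]_n :=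
  mdiff M (tproj M) x u *m v.

(* The value does not depend on the orthonormal family q with projector Q. *)
Definition sff_hat {R : realType} {n : nat} (k : nat) (M : set 'cV[R]_n)
    (x u : 'cV[R]_n) (Q : 'M[R]_n) : 'M[R]_n :=
  get [set S | exists q : 'I_k -> 'cV[R]_n,
    [/\ forall l, tangent M x (q l),
        forall i j, dot (q i) (q j) = (i == j)%:R,
        Q = \sum_(l < k) q l *m (q l)^T &
        S = \sum_(l < k) sff M x u (q l) *m (q l)^T +
            \sum_(l < k) q l *m (sff M x u (q l))^T]].

Definition reflection {R : realType} {n : nat} (P : 'M[R]_n)
    (u : 'cV[R]_n) : 'cV[R]_n :=
  u - 2%:R *: (P *m u).

Definition commutator {R : realType} {n : nat} (A B : 'M[R]_n) : 'M[R]_n :=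
  A *m B - B *m A.

(* Derivative relative to J; one-sided at an end point belonging to J. *)
Definition is_derive_within {R : realType} {W : normedModType R}
    (J : set R) (c : R -> W) (t : R) (w : W) : Prop :=
  (s - t)^-1 *: (c s - c t) @[s --> within J t^'] --> w.

(* rgrad, rhess and sff_hat carry their intended values only where (x t, P t)
   is on the Grassmann bundle; elsewhere this equation is not meaningful. *)
Definition saddle_dynamic {R : realType} {n : nat} (k : nat)
    (M : set 'cV[R]_n) (f : 'cV[R]_n -> R) (J : set R)
    (x : R -> 'cV[R]_n) (P : R -> 'M[R]_n) : Prop :=
  forall t, J t -> exists (dx : 'cV[R]_n) (dP : 'M[R]_n),
    [/\ is_derive_within J x t dx,
        is_derive_within J P t dP,
        dx = - reflection (P t) (rgrad M f (x t)) &
        dP = - commutator (P t) (commutator (P t) (rhess M f (x t)))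
             + sff_hat k M (x t) dx (P t)].

(* Main.v *)
Require Import Defs.
From mathcomp Require Import all_boot all_order all_algebra.
From mathcomp Require Import all_classical all_reals all_analysis.
From mathcomp Require Import ring lra.
Import Order.TTheory GRing.Theory Num.Theory.
Import numFieldNormedType.Exports.
Local Open Scope classical_set_scope.
Local Open Scope ring_scope.

(** The right-hand side of the dynamic is a vector field [F] on the compact
    bundle [K], regarded as a subset of the space of [n x (1 + n)] matrices. In
    a chart the tangent projector is [1 - N^T G^-1 N], where [N] is the matrix
    of differentials of the defining functions of [M]; it extends smoothly off
    [M], so [F] is locally Lipschitz on [K], hence Lipschitz by compactness.
    Moreover [F] is tangent to [K]: if [c] is a curve of [M] with velocity [u]
    and [Pi] the tangent projector along [c], then the orthogonal projector onto
    the range of [Pi (1 - t H) P] moves in [K] with the prescribed velocity,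
    because the Hessian [H] is symmetric. Extend [F] to a bounded Lipschitz
    field on the whole space and solve the equation there for all times; the
    distance of the solution to [K] satisfies a Gronwall inequality, so the
    solution never leaves [K]. Uniqueness is Gronwall again. *)

Set Implicit Arguments.
Unset Strict Implicit.
Unset Printing Implicit Defensive.

(** * Orthogonal projectors *)

(** [rgrad], [rhess] and [sff_hat] are chosen by [get] and carry meaning on the bundle only, so they
    cannot be differentiated or estimated directly. Near each point of [M] they are rewritten
    through a matrix function [T], smooth on an open set, a projector throughout it and the tangent
    projector on [M]; its derivative [dT] carries all the curvature. Two identities do the work.
    [T (dT u) T = 0], from [T T = T], cancels the unwanted terms in the velocity of the moving
    projector. [dT u v = dT v u] on tangent vectors, which comes from Schwarz's theorem for the
    defining functions, makes the Hessian symmetric. The Grassmann bundle is never made into a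
    manifold. Besides a Lipschitz field, the invariance argument asks only that the set be compact
    and that through each of its points there pass a curve with the prescribed velocity that stays
    in the set for small nonnegative times. An explicit curve of projectors is therefore enough,
    without an atlas. The rank condition, not visibly closed, is handled as a condition on the
    trace. *)

Lemma mxtrace_idempotent {F : fieldType} {n : nat} (P : 'M[F]_n) :
  P *m P = P -> \tr P = (\rank P)%:R.
Proof.
move=> PP; move: (mulmx_base P) (row_base_free P) (col_base_full P).
move: (col_base P) (row_base P) => C B PE Bfree Cfull.
(* [C] has full column rank and [B] full row rank, so [C B C B = C B] cancels on both sides. *)
have BC1 : B *m C = 1%:M.
  apply: (row_free_inj Bfree); apply: (row_full_inj Cfull) => /=.
  by rewrite mul1mx !mulmxA PE -mulmxA PE PP.
by rewrite -[in LHS]PE mxtrace_mulC BC1 mxtrace1.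
Qed.

Section dot_theory.
Context {R : realType} {n : nat}.
Implicit Types (u v w : 'cV[R]_n) (P Q : 'M[R]_n).

Lemma dotC u v : dot u v = dot v u.
Proof. by rewrite /dot -[in LHS](trmxK (u^T *m v)) mxE trmx_mul trmxK. Qed.

Lemma dot_mull P u v : dot (P *m u) v = dot u (P^T *m v).
Proof. by rewrite /dot trmx_mul mulmxA. Qed.

Lemma dotE u v : dot u v = \sum_i u i 0 * v i 0.
Proof. by rewrite /dot mxE; apply: eq_bigr => i _; rewrite mxE. Qed.

Lemma dotBl u v w : dot (u - v) w = dot u w - dot v w.
Proof. by rewrite /dot linearB /= mulmxBl !mxE. Qed.

Lemma dotDl u v w : dot (u + v) w = dot u w + dot v w.
Proof. by rewrite /dot linearD /= mulmxDl !mxE. Qed.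

Lemma dotZl (a : R) u v : dot (a *: u) v = a * dot u v.
Proof. by rewrite /dot linearZ /= -scalemxAl mxE. Qed.

Lemma dotZr (a : R) u v : dot u (a *: v) = a * dot u v.
Proof. by rewrite dotC dotZl dotC. Qed.

Lemma dot_ge0 u : 0 <= dot u u.
Proof. by rewrite dotE sumr_ge0 // => i _; rewrite -expr2 sqr_ge0. Qed.

Lemma dot_eq0 u : dot u u = 0 -> u = 0.
Proof.
rewrite dotE => /eqP; rewrite psumr_eq0; last by move=> i _; rewrite -expr2 sqr_ge0.
move=> /allP u0; apply/colP => i; rewrite mxE.
by have := u0 i (mem_index_enum _); rewrite /= -expr2 sqrf_eq0 => /eqP.
Qed.

Lemma mulmx_tr_cV u v w : u *m v^T *m w = dot v w *: u.
Proof.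
rewrite -mulmxA /dot [v^T *m w]mx11_scalar mul_mx_scalar.
by rewrite [in RHS]mxE eqxx mulr1n.
Qed.

Lemma mxtrace_cV u v : \tr (u *m v^T) = dot v u.
Proof. by rewrite mxtrace_mulC /dot /mxtrace big_ord1. Qed.

(** Each projector fixes the columns of the other, so [Q P = P] and [P Q = Q]; transposing the
    second identity gives [Q P = Q]. *)
Lemma orth_projector_uniq S P Q :
  orth_projector S P -> orth_projector S Q -> P = Q.
Proof.
have aux P' Q' : orth_projector S P' -> orth_projector S Q' -> Q' *m P' = P'.
  move=> [_ _ PS] [_ QQ QS]; apply/matrixP => i j.
  have : S (P' *m delta_mx j 0) by rewrite -PS; exists (delta_mx j 0).
  rewrite -QS => -[w _ wE].
  have : col j (Q' *m P') = col j P'.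
    by rewrite !colE -mulmxA -wE mulmxA QQ.
  by move=> /colP/(_ i); rewrite !mxE.
move=> hP hQ; rewrite -[LHS](aux _ _ hP hQ).
have [PT _ _] := hP; have [QT _ _] := hQ.
by rewrite -[RHS]trmxK QT -[in RHS](aux _ _ hQ hP) trmx_mul PT QT.
Qed.

(** By [P = P P^T] the entry [P a a] is the sum of the squares of row [a]. Hence
    [(P a b)^2 <= P a a], and [b = a] gives [P a a <= 1]. *)
Lemma projector_entry_le1 P i j : P^T = P -> P *m P = P -> `|P i j| <= 1.
Proof.
move=> PT PP.
have diag a b : (P a b) ^+ 2 <= P a a.
  rewrite -[in leRHS]PP mxE (bigD1 b) //= -[X in _ * X]/(P b a) -[in P b a]PT.
  rewrite mxE -expr2 lerDl sumr_ge0 // => l _.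
  by rewrite -[in P l a]PT mxE -expr2 sqr_ge0.
have d1 : P i i <= 1.
  have h := diag i i; have [P0|P0] := leP (P i i) 0; first exact: le_trans P0 ler01.
  by move: h; rewrite expr2 -ler_pdivlMr // divff ?gt_eqF.
rewrite -(@expr_le1 _ 2%N) // -normrX ger0_norm ?sqr_ge0 //.
exact: le_trans (diag i j) d1.
Qed.

Lemma sum_projector_mul {k} (q : 'I_k -> 'cV[R]_n) j :
  (forall i j, dot (q i) (q j) = (i == j)%:R) ->
  (\sum_(l < k) q l *m (q l)^T) *m q j = q j.
Proof.
move=> qq; rewrite mulmx_suml (bigD1 j) //= mulmx_tr_cV qq eqxx scale1r.
by rewrite big1 ?addr0 // => i /negPf ij; rewrite mulmx_tr_cV qq ij scale0r.
Qed.

(** Induction on the rank: a nonzero column of [Q] is normalised to [u], and [Q - u u^T] is again a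
    projector, whose trace, hence rank, is one less. This supplies the family that [sff_hat] asks
    for. *)
Lemma projector_orthonormal k Q : Q^T = Q -> Q *m Q = Q -> \rank Q = k ->
  exists q : 'I_k -> 'cV[R]_n,
    (forall i j, dot (q i) (q j) = (i == j)%:R) /\
    Q = \sum_(l < k) q l *m (q l)^T.
Proof.
elim: k Q => [|k IH] Q QT QQ rQ.
  exists (fun=> 0); split; first by case.
  by rewrite big_ord0; apply/eqP; rewrite -mxrank_eq0 rQ.
have [u [u1 Qu]] : exists u, dot u u = 1 /\ Q *m u = u.
  have /matrix0Pn[i [j Qij]] : Q != 0 by rewrite -mxrank_eq0 rQ.
  pose v : 'cV[R]_n := Q *m delta_mx j 0.
  have v0 : v != 0.
    by apply: contraNneq Qij => /colP/(_ i); rewrite /v -colE !mxE => ->.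
  have d0 : 0 < dot v v.
    by rewrite lt_neqAle dot_ge0 andbT eq_sym; apply: contraNneq v0 => /dot_eq0 ->.
  exists ((Num.sqrt (dot v v))^-1 *: v); split.
    rewrite dotZl dotZr mulrA -invfM -expr2 sqr_sqrtr ?dot_ge0 //.
    by rewrite mulVf // gt_eqF.
  by rewrite -scalemxAr /v mulmxA QQ.
have uQ : u^T *m Q = u^T by rewrite -[in LHS]QT -trmx_mul Qu.
pose Q' := Q - u *m u^T.
have uuu : u *m u^T *m u = u by rewrite mulmx_tr_cV u1 scale1r.
have Q'u : Q' *m u = 0 by rewrite mulmxBl uuu Qu subrr.
have Q'T : Q'^T = Q' by rewrite linearB /= QT trmx_mul trmxK.
have Q'Q' : Q' *m Q' = Q'.
  by rewrite {2}/Q' mulmxBr [Q' *m (u *m _)]mulmxA Q'u mul0mx subr0 /Q'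
    mulmxBl QQ -mulmxA uQ.
have rQ' : \rank Q' = k.
  apply/eqP; rewrite -(eqr_nat R) -mxtrace_idempotent // linearB /= mxtrace_cV u1.
  by rewrite mxtrace_idempotent // rQ -natr1 addrK.
have [q [qq Q'E]] := IH _ Q'T Q'Q' rQ'.
have uq i : dot u (q i) = 0.
  have <- : Q' *m q i = q i by rewrite Q'E sum_projector_mul.
  by rewrite dotC dot_mull Q'T Q'u /dot mulmx0 mxE.
exists (fun i => if unlift ord0 i is Some j then q j else u); split.
  move=> i j; case: (unliftP ord0 i) => [i'|] ->; case: (unliftP ord0 j) => [j'|] ->.
  - by rewrite qq (inj_eq lift_inj).
  - by rewrite dotC uq.
  - by rewrite uq.
  - by rewrite u1 eqxx.
rewrite big_ord_recl unlift_none.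
under eq_bigr do rewrite liftK.
by rewrite -Q'E /Q' addrC subrK.
Qed.

End dot_theory.

(** * Ordinary differential equations on a compact set *)

Section matrix_norm.
Context {R : realType} {m n : nat}.
Implicit Types A : 'M[R]_(m, n).

Lemma normmx_entry A i j : `|A i j| <= `|A|.
Proof.
rewrite [leRHS]/Num.Def.normr /= mx_normrE.
by apply: le_trans (le_bigmax _ _ (i, j)).
Qed.

Lemma normmx_le A (c : R) : 0 <= c -> (forall i j, `|A i j| <= c) -> `|A| <= c.
Proof.
by move=> c0 Ac; rewrite [leLHS]/Num.Def.normr /= mx_normrE bigmax_le // => -[i j] _.
Qed.

End matrix_norm.

Section antiderivative.
Context {R : realType}.
Implicit Types (g H h : R -> R) (b t : R).

(* The base point -1 makes the primitive two-sided differentiable at 0. *)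
Definition primitive g t : R :=
  (\int[lebesgue_measure]_(s in `[-1, t]) g s)%R -
  (\int[lebesgue_measure]_(s in `[-1, 0%R]) g s)%R.

Lemma primitive0 g : primitive g 0 = 0.
Proof. by rewrite /primitive subrr. Qed.

Lemma is_derive_primitive g t : continuous g -> -1 < t ->
  is_derive t (1 : R) (primitive g) (g t).
Proof.
move=> cg t1.
have [||dF F'] := @continuous_FTC1_closed R g (-1) t (t + 1) _ _ t1 (cg t).
- by rewrite ltrDl.
- apply: continuous_compact_integrable; first exact: segment_compact.
  exact: continuous_subspaceT.
have -> : primitive g = (fun x => \int[lebesgue_measure]_(s in `[-1, x]) g s)%R -
    cst (\int[lebesgue_measure]_(s in `[-1, 0%R]) g s)%R by [].
have ? := derivableP dF; apply: is_derive_eq.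
by rewrite subr0 -derive1E.
Qed.

Lemma le_of_derive_le (F G dF dG : R -> R) (a b : R) : a <= b -> F a <= G a ->
  (forall s, a <= s <= b -> is_derive s (1 : R) F (dF s)) ->
  (forall s, a <= s <= b -> is_derive s (1 : R) G (dG s)) ->
  (forall s, a <= s <= b -> dF s <= dG s) -> F b <= G b.
Proof.
move=> ab FGa hF hG hd.
have inab s : s \in `]a, b[ -> a <= s <= b.
  by rewrite in_itv /= => /andP[/ltW -> /ltW ->].
have dGF s : a <= s <= b -> is_derive s (1 : R) (G - F) (dG s - dF s).
  by move=> sab; have ? := hF s sab; have ? := hG s sab; apply: is_deriveB.
rewrite -subr_ge0 (le_trans _ (_ : G a - F a <= _)) ?subr_ge0 //.
apply: (@ger0_derive1_le_cc R (G - F) a b) => //; rewrite ?in_itv /= ?lexx ?ab //.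
- by move=> s /inab sab; have [] := dGF s sab.
- move=> s /inab sab; have [_] := dGF s sab.
  by rewrite derive1E => ->; rewrite subr_ge0 hd.
- apply: derivable_within_continuous => s; rewrite in_itv /= => sab.
  by have [] := dGF s sab.
Qed.

Lemma primitive_le g H h b : continuous g -> 0 <= b -> 0 <= H 0 ->
  (forall t, 0 <= t -> is_derive t (1 : R) H (h t)) ->
  (forall t, 0 <= t -> `|g t| <= h t) -> `|primitive g b| <= H b.
Proof.
move=> cg b0 H0 dH gh.
have dp s : 0 <= s <= b -> is_derive s (1 : R) (primitive g) (g s).
  by move=> /andP[s0 _]; apply: is_derive_primitive => //; apply: lt_le_trans s0; rewrite ltrN10.
have dH' s : 0 <= s <= b -> is_derive s (1 : R) H (h s).
  by move=> /andP[s0 _]; exact: dH.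
rewrite ler_norml; apply/andP; split.
  apply: (@le_of_derive_le (- H) (primitive g) (- h) g 0 b) => //.
  - by rewrite primitive0 oppr_le0.
  - by move=> s sb; have ? := dH' s sb; apply: is_deriveN.
  - by move=> s /andP[/gh + _]; rewrite ler_norml => /andP[].
apply: (@le_of_derive_le (primitive g) H g h 0 b) => //.
  by rewrite primitive0.
by move=> s /andP[/gh + _]; rewrite ler_norml => /andP[].
Qed.

Lemma primitiveB g g' b : continuous g -> continuous g' -> 0 <= b ->
  primitive g b - primitive g' b = primitive (fun s => g s - g' s) b.
Proof.
move=> cg cg' b0.
have cgg' : continuous (fun s => g s - g' s).
  by move=> s; apply: continuousB; [exact: cg|exact: cg'].
have d s : 0 <= s <= b -> -1 < s.
  by move=> /andP[s0 _]; apply: lt_le_trans s0; rewrite ltrN10.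
have e0 : (primitive g - primitive g') 0 = primitive (fun s => g s - g' s) 0.
  by rewrite /= !primitive0; change (primitive g 0 - primitive g' 0 = 0);
    rewrite !primitive0 subrr.
have d1 s : 0 <= s <= b ->
    is_derive s (1 : R) (primitive g - primitive g') (g s - g' s).
  move=> /d s1; have ? := is_derive_primitive cg s1.
  by have ? := is_derive_primitive cg' s1; apply: is_deriveB.
have d2 s : 0 <= s <= b ->
    is_derive s (1 : R) (primitive (fun s => g s - g' s)) (g s - g' s).
  by move=> /d s1; exact: is_derive_primitive.
apply/eqP; rewrite eq_le; apply/andP; split.
  by apply: (le_of_derive_le b0 _ d1 d2) => //; rewrite e0.
by apply: (le_of_derive_le b0 _ d2 d1) => //; rewrite e0.
Qed.

Lemma primitive_lip g (B a b : R) : continuous g -> (forall s, `|g s| <= B) ->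
  0 <= a -> 0 <= b -> `|primitive g a - primitive g b| <= B * `|a - b|.
Proof.
move=> cg gB.
have B0 : 0 <= B by apply: le_trans (gB 0).
suff wl a' b' : 0 <= b' -> b' <= a' ->
    `|primitive g a' - primitive g b'| <= B * `|a' - b'|.
  move=> a0 b0; have [ab|/ltW ba] := leP a b; last exact: wl.
  by rewrite distrC [`|a - b|]distrC; exact: wl.
move=> b0 ba.
have d s : b' <= s <= a' -> is_derive s (1 : R) (primitive g) (g s).
  move=> /andP[s0 _]; apply: is_derive_primitive => //.
  by apply: lt_le_trans s0; apply: lt_le_trans b0; rewrite ltrN10.
have [||c _ ->] := MVT_segment ba (df := g) (f := primitive g).
- by move=> s; rewrite in_itv /= => /andP[/ltW s1 /ltW s2]; apply: d; rewrite s1.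
- apply: derivable_within_continuous => s; rewrite in_itv /= => sab.
  by have [] := d s sab.
by rewrite normrM ler_wpM2r.
Qed.

End antiderivative.

Lemma geometric_cauchy {R : realType} (u : nat -> R) (C : R) :
  (forall n, `|u n.+1 - u n| <= C / 2 ^+ n) ->
  exists l, forall n, `|l - u n| <= C * 2 / 2 ^+ n.
Proof.
move=> hu.
have C0 : 0 <= C by have := hu 0%N; rewrite expr0 divr1; apply: le_trans.
have cu : cvgn (series (telescope u)).
  apply: normed_cvg; apply: (@series_le_cvg _ _ (geometric C 2^-1)) => /=.
  - by move=> k.
  - by move=> k; rewrite mulr_ge0 // exprn_ge0 // invr_ge0.
  - by move=> k; rewrite exprVn; exact: hu.
  - by apply: is_cvg_geometric_series; rewrite ger0_norm ?invr_ge0 //; lra.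
have hk n k : `|u (n + k)%N - u n| <= C * 2 / 2 ^+ n.
  (* The part of the geometric series not yet summed is subtracted, which makes the bound inductive
     in [k]. *)
  suff : `|u (n + k)%N - u n| <= C * 2 / 2 ^+ n - C * 2 / 2 ^+ (n + k)%N.
    move=> h; apply: le_trans h _; rewrite lerBlDr lerDl.
    by rewrite mulr_ge0 ?invr_ge0 ?exprn_ge0 // mulr_ge0.
  elim: k => [|k IH]; first by rewrite addn0 !subrr normr0.
  have e1 : C * 2 / 2 ^+ (n + k).+1 = C / 2 ^+ (n + k).
    by rewrite exprSr; field; rewrite expf_neq0.
  have e2 : C * 2 / 2 ^+ (n + k) = C / 2 ^+ (n + k) *+ 2 by rewrite mulrAC mulr_natr.
  have := hu (n + k)%N; have := ler_distD (u (n + k)%N) (u (n + k).+1) (u n).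
  by rewrite addnS e1; move: IH; rewrite e2; lra.
exists (u 0%N + limn (series (telescope u))) => n.
have hl : u k @[k --> \oo] --> u 0%N + limn (series (telescope u)).
  rewrite [X in X @ _](_ : u = (fun k => u 0%N + series (telescope u) k)); last first.
    by apply/funext => k; rewrite -eq_sum_telescope.
  by apply: cvgD => //; exact: cvg_cst.
have hln : `|u k - u n| @[k --> \oo] --> `|(u 0%N + limn (series (telescope u))) - u n|.
  by apply: cvg_norm; apply: cvgB => //; exact: cvg_cst.
rewrite -(cvg_lim _ hln) //; apply: limr_le; first exact: (cvgP _ hln).
near=> k.
have nk : (n <= k)%N by near: k; exists n.
by rewrite -(subnKC nk); exact: hk.
Unshelve. all: by end_near. Qed.

Section derive_estimates.
Context {R : realType} {W : normedModType R}.
Implicit Types (J : set R) (c : R -> W) (t : R) (w : W).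

(** Clearing the quotient gives an estimate that also holds at [s = t] and can be added up in the
    Gronwall arguments. *)
Lemma is_derive_withinP J c t w :
  is_derive_within J c t w <->
  forall e, 0 < e -> exists2 d, 0 < d & forall s, J s -> `|s - t| < d ->
    `|c s - c t - (s - t) *: w| <= e * `|s - t|.
Proof.
have aux s e : s != t -> (`|w - (s - t)^-1 *: (c s - c t)| <= e) =
    (`|c s - c t - (s - t) *: w| <= e * `|s - t|).
  rewrite -subr_eq0 => st0; rewrite -ler_pdivrMr ?normr_gt0 //.
  congr (_ <= _); rewrite -normfV mulrC -normrZ [in RHS]scalerBr scalerA.
  by rewrite mulVf // scale1r distrC.
rewrite /is_derive_within; split.
  move=> /cvgrPdist_le h e e0; have := h e e0.
  rewrite near_withinE => -[d /= d0 hd]; exists d => // s Js std.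
  have [->|st] := eqVneq s t.
    by rewrite !subrr scale0r subrr !normr0 mulr0.
  by rewrite -aux //; apply: hd => //=; rewrite distrC.
move=> h; apply/cvgrPdist_le => e e0; have [d d0 hd] := h e e0.
rewrite near_withinE; exists d => //= s std st Js.
by rewrite aux //; apply: hd => //; rewrite distrC.
Qed.

Lemma is_derive_dist c t w : is_derive t (1 : R) c w ->
  forall e, 0 < e -> exists2 d, 0 < d & forall s, `|s - t| < d ->
    `|c s - c t - (s - t) *: w| <= e * `|s - t|.
Proof.
move=> [dc cw] e e0.
have : h^-1 *: (c (h *: (1 : R) + t) - c t) @[h --> 0^'] --> w.
  by rewrite -cw; exact: dc.
move=> /cvgrPdist_le/(_ e e0) [d /= d0 hd]; exists d => // s std.
have [->|st] := eqVneq s t.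
  by rewrite !subrr scale0r subrr !normr0 mulr0.
have st0 : s - t != 0 by rewrite subr_eq0.
have := hd (s - t); rewrite /= sub0r normrN => /(_ std st0).
rewrite [_ *: 1]mulr1 subrK => h; rewrite -ler_pdivrMr ?normr_gt0 //.
apply: le_trans h; rewrite -normfV mulrC -normrZ [in leLHS]scalerBr scalerA.
by rewrite mulVf // scale1r distrC.
Qed.

Lemma is_derive_within_is_derive J c g t w : is_derive t (1 : R) g w -> J t ->
  (forall s, J s -> c s = g s) -> is_derive_within J c t w.
Proof.
move=> dg Jt cg; apply/is_derive_withinP => e e0.
have [d d0 hd] := is_derive_dist dg e0; exists d => // s Js st.
by rewrite !cg //; exact: hd.
Qed.

End derive_estimates.

Lemma is_derive_mx {R : realType} {V : normedModType R} {m n : nat}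
    (M : V -> 'M[R]_(m, n)) t v (D : 'M[R]_(m, n)) :
  (forall i j, is_derive t v (fun s => M s i j) (D i j)) -> is_derive t v M D.
Proof.
move=> h; have dM : derivable M t v.
  by apply/derivable_mxP => i j; have [] := h i j.
split=> //; rewrite derive_mx //; apply/matrixP => i j; rewrite mxE.
by have [] := h i j.
Qed.

Lemma is_derive_mx_entry {R : realType} {V : normedModType R} {m n : nat}
    (M : V -> 'M[R]_(m, n)) t v (D : 'M[R]_(m, n)) i j :
  is_derive t v M D -> is_derive t v (fun s => M s i j) (D i j).
Proof.
move=> [dM <-]; rewrite derive_mx // mxE; apply: derivableP.
by move/derivable_mxP : dM.
Qed.

Lemma lipschitz_dist_continuous {R : realType} {V W : normedModType R}
    (g : V -> W) (K : R) :
  (forall s t, `|g s - g t| <= K * `|s - t|) -> continuous g.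
Proof.
move=> gK s; apply/cvgrPdist_le => e e0.
have K1 : 0 < `|K| + 1 by rewrite ltr_wpDl.
apply/nbhs_ballP; exists (e / (`|K| + 1)); first by rewrite /= divr_gt0.
move=> t; rewrite -ball_normE /= => st; apply: le_trans (gK s t) _.
rewrite (@le_trans _ _ ((`|K| + 1) * `|s - t|)) //.
  by rewrite ler_wpM2r // (le_trans (ler_norm K)) // lerDl.
by rewrite mulrC -ler_pdivlMr // ltW.
Qed.

Lemma le_half_pow {R : realType} (a b c : R) :
  (forall n, a <= b + c / 2 ^+ n) -> a <= b.
Proof.
move=> h.
have cv : b + c * (2^-1) ^+ n @[n --> \oo] --> b + c * 0.
  apply: cvgD; first exact: cvg_cst.
  by apply: cvgM; [exact: cvg_cst|apply: cvg_expr; rewrite ger0_norm ?invr_ge0 //; lra].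
rewrite mulr0 addr0 in cv.
rewrite -(cvg_lim _ cv) //; apply: limr_ge; first exact: (cvgP _ cv).
by apply: nearW => n; rewrite exprVn; exact: h.
Qed.

Lemma max0_dist {R : realType} (s t : R) :
  `|Num.max s 0 - Num.max t 0| <= `|s - t|.
Proof.
have wl (a b : R) : a <= b -> `|Num.max a 0 - Num.max b 0| <= `|a - b|.
  move=> ab; rewrite !(distrC _ (_ b _)) [`|a - b|]distrC.
  rewrite (@ger0_norm _ (b - a)) ?subr_ge0 //.
  by case: (leP a 0) => a0; case: (leP b 0) => b0; rewrite ler_norml; lra.
have [st|/ltW ts] := leP s t; first exact: wl.
by rewrite distrC [leRHS]distrC; exact: wl.
Qed.

(** * Global solution of a bounded Lipschitz equation by Picard iteration *)

Section picard.
Context {R : realType} {m n : nat}.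
Variables (F : 'M[R]_(m, n) -> 'M[R]_(m, n)) (L B : R) (z0 : 'M[R]_(m, n)).
Hypothesis L0 : 0 < L.
Hypothesis FL : forall a b, `|F a - F b| <= L * `|a - b|.
Hypothesis FB : forall a, `|F a| <= B.

Let B0 : 0 <= B. Proof. exact: le_trans (FB 0). Qed.

(** Freezing time at 0 on the left makes every iterate Lipschitz on the whole line, as the
    continuity hypotheses on primitives require. *)
Let step (p : R -> 'M[R]_(m, n)) t : 'M[R]_(m, n) :=
  z0 + \matrix_(i, j) primitive (fun s => F (p s) i j) (Num.max t 0).

Let lipB (p : R -> 'M[R]_(m, n)) := forall s t, `|p s - p t| <= B * `|s - t|.

Let cont_F p i j : lipB p -> continuous (fun s => F (p s) i j : R).
Proof.
move=> pB; apply: (@lipschitz_dist_continuous _ _ _ _ (L * B)) => s t.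
have -> : F (p s) i j - F (p t) i j = (F (p s) - F (p t)) i j by rewrite !mxE.
apply: le_trans (normmx_entry _ _ _) _; apply: le_trans (FL _ _) _.
by rewrite -mulrA ler_pM2l.
Qed.

Let FB_entry a i j : `|F a i j| <= B.
Proof. exact: le_trans (normmx_entry _ _ _) (FB a). Qed.

Let max0_ge0 (t : R) : 0 <= Num.max t 0. Proof. by rewrite le_max lexx orbT. Qed.

Let lipB_step p : lipB p -> lipB (step p).
Proof.
move=> pB s t; rewrite /step opprD addrACA subrr add0r; apply: normmx_le.
  by rewrite mulr_ge0.
move=> i j; rewrite !mxE.
have h := primitive_lip (cont_F (i:=i) (j:=j) pB) (fun s' => FB_entry (p s') i j)
  (max0_ge0 s) (max0_ge0 t).
by apply: le_trans h _; rewrite ler_wpM2l // max0_dist.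
Qed.

(** Exponential weight of Bielecki: the integral of [L * weight D] from 0 to [t] is at most
    [weight (D / 2) t]. The Picard step thus halves the weighted distance on the whole half-line at
    once, and no local solutions have to be glued. *)
Let weight D t := D * expR (2 * L * t).

Let is_derive_weight D (t : R) :
  is_derive t (1 : R) (weight D) (2 * L * D * expR (2 * L * t)).
Proof.
rewrite /weight.
have h : is_derive t (1 : R) (fun s => 2 * L * s) (2 * L).
  have -> : (fun s => 2 * L * s) = (2 * L) \*: (id : R -> R) by [].
  by apply: is_derive_eq; rewrite [LHS]mulr1.
have -> : (fun s => D * expR (2 * L * s)) = D \*: (expR \o (fun s => 2 * L * s)) by [].
apply: is_derive_eq => /=.
by change (D * (expR (2 * L * t) * (2 * L)) = 2 * L * D * expR (2 * L * t)); ring.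
Qed.

Let step_dist p q D : lipB p -> lipB q -> 0 <= D ->
  (forall s, 0 <= s -> `|p s - q s| <= weight D s) ->
  forall t, `|step p t - step q t| <= weight (D / 2) (Num.max t 0).
Proof.
move=> pB qB D0 pq t; rewrite /step opprD addrACA subrr add0r; apply: normmx_le.
  by rewrite mulr_ge0 ?expR_ge0 // divr_ge0.
move=> i j; rewrite !mxE primitiveB //; [|exact: cont_F|exact: cont_F].
apply: (@primitive_le _ _ _ (fun t => L * weight D t)) => //.
- by move=> s; apply: continuousB; exact: cont_F.
- by rewrite mulr_ge0 ?expR_ge0 // divr_ge0.
- move=> s s0; have -> : L * weight D s = 2 * L * (D / 2) * expR (2 * L * s).
    by rewrite /weight; field.
  exact: is_derive_weight.
- move=> s s0.
  have -> : F (p s) i j - F (q s) i j = (F (p s) - F (q s)) i j by rewrite !mxE.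
  apply: le_trans (normmx_entry _ _ _) _; apply: le_trans (FL _ _) _.
  by rewrite ler_pM2l //; exact: pq.
Qed.

Lemma picard : exists2 z : R -> 'M[R]_(m, n), z 0 = z0 &
  forall t, 0 <= t -> is_derive_within [set s | 0 <= s] z t (F (z t)).
Proof.
pose p k := iter k step (cst z0).
have pB k : lipB (p k).
  elim: k => [|k IH]; last exact: lipB_step.
  by move=> s t; rewrite subrr normr0 mulr_ge0.
(* The first increment is the integral of a function bounded by [B], and
   [B <= 2 * L * C * expR (2 * L * s)] for [s >= 0], the derivative of [weight C]. *)
pose C := B / (2 * L).
have C0 : 0 <= C by rewrite divr_ge0 // mulr_ge0 // ltW.
have pd k t : `|p k.+1 t - p k t| <= weight (C / 2 ^+ k) (Num.max t 0).
  elim: k t => [|k IH] t.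
    rewrite expr0 divr1 /= /step addrAC subrr add0r; apply: normmx_le.
      by rewrite mulr_ge0 ?expR_ge0.
    move=> i j; rewrite mxE.
    apply: (@primitive_le _ _ _ (fun t => 2 * L * C * expR (2 * L * t))) => //.
    - by move=> s; exact: cst_continuous.
    - by rewrite mulr_ge0 ?expR_ge0.
    - move=> s s0; have -> : 2 * L * C = B.
        by rewrite /C mulrC divfK // mulf_neq0 // gt_eqF.
      apply: le_trans (FB_entry _ _ _) _; rewrite ler_peMr //.
      rewrite (le_trans _ (expR_ge1Dx _)) // lerDl mulr_ge0 // mulr_ge0 //.
      exact: ltW.
  rewrite exprSr invfM mulrA; apply: (step_dist (pB k.+1) (pB k)).
    by rewrite divr_ge0 // exprn_ge0.
  by move=> s s0; apply: le_trans (IH s) _; rewrite max_l.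
pose E t := weight C (Num.max t 0).
have pdE k t i j : `|p k.+1 t i j - p k t i j| <= E t / 2 ^+ k.
  have -> : p k.+1 t i j - p k t i j = (p k.+1 t - p k t) i j by rewrite !mxE.
  apply: le_trans (normmx_entry _ _ _) _; apply: le_trans (pd k t) _.
  by rewrite /E /weight mulrAC.
have /choice[zz hz] : forall x : R * 'I_m * 'I_n, exists l,
    forall k, `|l - p k x.1.1 x.1.2 x.2| <= E x.1.1 * 2 / 2 ^+ k.
  by move=> [[t i] j]; apply: geometric_cauchy => k; exact: pdE.
pose z t : 'M[R]_(m, n) := \matrix_(i, j) zz (t, i, j).
have E0 t : 0 <= E t by rewrite mulr_ge0 ?expR_ge0.
have zp k t : `|z t - p k t| <= E t * 2 / 2 ^+ k.
  apply: normmx_le => [|i j]; first by rewrite divr_ge0 ?exprn_ge0 // mulr_ge0.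
  by rewrite !mxE; exact: (hz (t, i, j) k).
have zB : lipB z.
  move=> s t; apply: (@le_half_pow _ _ _ (E s * 2 + E t * 2)) => k.
  have := zp k s; have := zp k t; have := pB k s t.
  have := ler_distD (p k s) (z s) (z t); have := ler_distD (p k t) (p k s) (z t).
  by rewrite (distrC (p k t)) mulrDl; lra.
(* Both sides are within [E t / 2 ^+ k] of [p k.+1 t]: the left by the rate of convergence, the
   right by the contraction applied to [p k] and [z]. *)
have zE t : z t = step z t.
  apply/eqP; rewrite -subr_eq0 -normr_le0.
  apply: (@le_half_pow _ _ _ (E t + E t)) => k; rewrite add0r.
  have h1 : `|z t - p k.+1 t| <= E t / 2 ^+ k.
    have -> : E t / 2 ^+ k = E t * 2 / 2 ^+ k.+1.
      by rewrite exprSr; field; rewrite expf_neq0.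
    exact: zp.
  have h2 : `|p k.+1 t - step z t| <= E t / 2 ^+ k.
    have := @step_dist (p k) z (C * 2 / 2 ^+ k) (pB k) zB _ _ t.
    have -> : weight (C * 2 / 2 ^+ k / 2) (Num.max t 0) = E t / 2 ^+ k.
      by rewrite /E /weight; field; rewrite expf_neq0.
    apply; first by rewrite divr_ge0 ?exprn_ge0 // mulr_ge0.
    move=> s s0; rewrite distrC; apply: le_trans (zp k s) _.
    by rewrite /E max_l // /weight le_eqVlt; apply/orP; left; apply/eqP; ring.
  rewrite mulrDl; apply: le_trans (ler_distD (p k.+1 t) _ _) _.
  exact: lerD h1 h2.
exists z.
  rewrite zE /step max_l //; apply/matrixP => i j.
  by rewrite !mxE primitive0 addr0.
move=> t t0.
apply: (@is_derive_within_is_derive _ _ _ _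
  (fun s => z0 + \matrix_(i, j) primitive (fun s => F (z s) i j) s)) => //.
  apply: is_derive_mx => i j.
  have -> : (fun s => (z0 + \matrix_(i, j) primitive (fun s => F (z s) i j) s) i j)
     = cst (z0 i j) + primitive (fun s => F (z s) i j).
    by apply/funext => s; rewrite !mxE.
  have ? : is_derive t (1 : R) (primitive (fun s => F (z s) i j)) (F (z t) i j).
    by apply: is_derive_primitive; [exact: cont_F|apply: lt_le_trans t0; rewrite ltrN10].
  by apply: is_derive_eq; rewrite add0r.
by move=> s /= s0; rewrite [LHS]zE /step max_l.
Qed.
End picard.

(** McShane's formula: the infimum over [w] in [K] of [g w + L * |a - w|] is Lipschitz with constant
    [L] and extends [g]. It is already at least [- B], so capping it at [B] secures the two-sided
    bound without changing it on [K]. *)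
Lemma mcshane {R : realType} {T : normedModType R} (K : set T) (g : T -> R) (L B : R) :
  0 <= L -> K !=set0 ->
  (forall a b, K a -> K b -> `|g a - g b| <= L * `|a - b|) ->
  (forall a, K a -> `|g a| <= B) ->
  exists G : T -> R, [/\ forall a b, `|G a - G b| <= L * `|a - b|,
    forall a, `|G a| <= B & forall a, K a -> G a = g a].
Proof.
move=> L0 [k0 Kk0] gL gB.
have B0 : 0 <= B by apply: le_trans (gB _ Kk0).
pose S a := [set g w + L * `|a - w| | w in K].
have S0 a : S a !=set0 by exists (g k0 + L * `|a - k0|); exists k0.
have gNB w : K w -> - B <= g w by move=> /gB; rewrite ler_norml => /andP[].
have SB a : lbound (S a) (- B).
  by move=> _ [w Kw <-]; rewrite (le_trans (gNB _ Kw)) // lerDl mulr_ge0.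
have iS a : has_inf (S a) by split => //; exists (- B); exact: SB.
have infS a b : inf (S a) <= inf (S b) + L * `|a - b|.
  rewrite -lerBlDr; apply: lb_le_inf => // _ [w Kw <-].
  rewrite lerBlDr; apply: (@le_trans _ _ (g w + L * `|a - w|)).
    by apply: ge_inf; [case: (iS a)|exists w].
  by rewrite -addrA lerD2l -mulrDr ler_wpM2l // [leRHS]addrC; exact: ler_distD.
exists (fun a => Num.min B (inf (S a))); split.
- have wl a b : Num.min B (inf (S a)) <= Num.min B (inf (S b)) + L * `|a - b|.
    have p : 0 <= L * `|a - b| by rewrite mulr_ge0.
    have := infS a b.
    by case: (leP B (inf (S b))) => h1; case: (leP B (inf (S a))) => h2; lra.
  move=> a b; rewrite ler_norml; apply/andP; split.
    by rewrite lerBrDl lerBlDr distrC; exact: wl.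
  by rewrite lerBlDl; exact: wl.
- move=> a; rewrite ler_norml; apply/andP; split; last by rewrite ge_min lexx.
  by rewrite le_min; apply/andP; split; [lra|exact: lb_le_inf].
- move=> a Ka.
  have -> : inf (S a) = g a.
    apply/eqP; rewrite eq_le; apply/andP; split.
      apply: ge_inf; first by case: (iS a).
      by exists a => //; rewrite subrr normr0 mulr0 addr0.
    apply: lb_le_inf => // _ [w Kw <-].
    by have := gL _ _ Ka Kw; rewrite ler_norml => /andP[_]; rewrite lerBlDl.
  by apply: min_r; have := gB _ Ka; rewrite ler_norml => /andP[].
Qed.

(** Comparison with the barrier [v t = e * expR ((L + 1) * t)]: its slope is at least [L * v + e]
    because [v >= e], so [d] cannot cross it; then [e] tends to 0. Besides continuity only a
    one-sided upper bound on increments is asked of [d], since a distance to a set need not be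
    differentiable. *)
Lemma dini_gronwall {R : realType} (d : R -> R) (L T : R) : 0 <= L -> d 0 <= 0 ->
  (forall t, 0 <= t < T -> forall e, 0 < e -> exists2 h, 0 < h &
     forall s, 0 <= s < T -> `|s - t| < h -> `|d s - d t| <= e) ->
  (forall t, 0 <= t < T -> forall e, 0 < e -> exists2 h, 0 < h &
     forall s, t < s < t + h -> s < T -> d s <= d t + (s - t) * (L * d t + e)) ->
  forall t, 0 <= t < T -> d t <= 0.
Proof.
move=> L0 d0 dc dd t1 /andP[t10 t1T].
suff main e : 0 < e -> d t1 <= e * expR ((L + 1) * t1).
  have e0 := expR_gt0 ((L + 1) * t1).
  apply/ler_addgt0Pr => e ep; rewrite add0r.
  have := main (e / expR ((L + 1) * t1)); rewrite divfK ?gt_eqF //; apply.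
  exact: divr_gt0.
move=> e0; pose v t := e * expR ((L + 1) * t).
have vmono a b : a <= b -> v a <= v b.
  by move=> ab; rewrite ler_pM2l // ler_expR ler_wpM2l // addr_ge0.
pose A := [set t | 0 <= t <= t1 /\ forall s, 0 <= s <= t -> d s <= v s].
have v0 t : 0 < v t by rewrite mulr_gt0 // expR_gt0.
have A0 : A 0.
  split=> [|s]; first by rewrite lexx.
  by rewrite -eq_le => /eqP <-; apply: le_trans d0 (ltW (v0 _)).
have Aub : ubound A t1 by move=> t [/andP[_ ]].
have hA : has_sup A by split; [exists 0|exists t1].
set s := sup A.
have s0 : 0 <= s := sup_upper_bound hA A0.
have st1 : s <= t1 by apply: ge_sup; [exists 0|].
have below r : 0 <= r < s -> d r <= v r.
  move=> /andP[r0 rs]; have sr : 0 < s - r by rewrite subr_gt0.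
  have [a [_ ha] /ltW] := sup_adherent sr hA.
  by rewrite -/s opprB addrCA subrr addr0 => ra; apply: ha; rewrite r0.
have sT : 0 <= s < T by rewrite s0 (le_lt_trans st1).
have dsv : d s <= v s.
  move: s0; rewrite le_eqVlt => /predU1P[<-|s0]; first exact: le_trans d0 (ltW (v0 _)).
  rewrite leNgt; apply/negP => vd.
  have [h h0 hh] := dc s sT ((d s - v s) / 2) ltac:(by rewrite divr_gt0 // subr_gt0).
  (* A time just before [s]: if [d] were above the barrier at [s], continuity would put it above at
     [r] already. *)
  pose r := Num.max 0 (s - h / 2).
  have rs : 0 <= r < s by rewrite le_max lexx /= gt_max s0 /= ltrBlDr ltrDl divr_gt0.
  have := hh r; rewrite (andP rs).1 (lt_trans (andP rs).2 (andP sT).2) => /(_ isT).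
  have rh : s - h / 2 <= r by rewrite le_max lexx orbT.
  have := andP rs => -[_ rs'].
  have rsh : `|r - s| < h by rewrite distrC ger0_norm ?subr_ge0 ?(ltW rs') //; lra.
  move=> /(_ rsh); rewrite ler_norml => /andP[h1 _].
  by have := below r rs; have := vmono _ _ (ltW rs'); lra.
have As : A s.
  split; first by rewrite s0.
  move=> r /andP[r0]; rewrite le_eqVlt => /predU1P[->//|rs].
  by apply: below; rewrite r0.
move: st1; rewrite le_eqVlt => /predU1P[<-//|st1].
have [h h0 hh] := dd s sT e e0.
pose r := Num.min t1 (s + h / 2).
have sr : s < r by rewrite lt_min st1 /= ltrDl divr_gt0.
have rt1 : r <= t1 by rewrite ge_min lexx.
have rh : r < s + h by rewrite gt_min; apply/orP; right; rewrite ltrD2l; lra.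
suff Ar : A r by have := sup_upper_bound hA Ar; rewrite leNgt sr.
split; first by rewrite rt1 andbT (le_trans s0) // ltW.
move=> q /andP[q0 qr]; have [qs|sq] := leP q s.
  by case: As => _; apply; rewrite q0.
have qh : s < q < s + h by rewrite sq (le_lt_trans qr).
apply: le_trans (hh q qh (le_lt_trans qr (le_lt_trans rt1 t1T))) _.
have vs : e <= v s.
  rewrite ler_peMr ?(ltW e0) // (le_trans _ (expR_ge1Dx _)) // lerDl mulr_ge0 //.
  by rewrite addr_ge0.
have -> : v q = v s * expR ((L + 1) * (q - s)).
  by rewrite /v -mulrA -expRD -mulrDr (addrC s) subrK.
apply: (@le_trans _ _ (v s * (1 + (L + 1) * (q - s)))); last first.
  by rewrite ler_pM2l // expR_ge1Dx.
have h1 : (q - s) * (L * d s + e) <= (q - s) * ((L + 1) * v s).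
  rewrite ler_pM2l ?subr_gt0 // mulrDl mul1r lerD // ler_wpM2l //.
have -> : v s * (1 + (L + 1) * (q - s)) = v s + (q - s) * ((L + 1) * v s) by ring.
exact: lerD.
Qed.

Lemma sub_is_derive_within {R : realType} {W : normedModType R} (J J' : set R)
    (c : R -> W) t w :
  J' `<=` J -> is_derive_within J c t w -> is_derive_within J' c t w.
Proof.
move=> JJ /is_derive_withinP h; apply/is_derive_withinP => e e0.
by have [d d0 hd] := h e e0; exists d => // s /JJ; exact: hd.
Qed.

Lemma is_derive_within_dist_le {R : realType} {W : normedModType R} (J : set R)
    (c : R -> W) t w : is_derive_within J c t w ->
  forall e, 0 < e -> exists2 h, 0 < h &
    forall s, J s -> `|s - t| < h -> `|c s - c t| <= e.
Proof.
move=> /is_derive_withinP/(_ 1 ltr01)[d d0 hd] e e0.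
have w0 : 0 < `|w| + 1 by rewrite ltr_wpDl.
exists (Num.min d (e / (`|w| + 1))); first by rewrite lt_min d0 divr_gt0.
move=> s Js; rewrite lt_min => /andP[sd se].
have := hd s Js sd; rewrite mul1r => h.
have := ler_distD ((s - t) *: w) (c s - c t) 0; rewrite !subr0 normrZ => h2.
apply: le_trans h2 _; apply: le_trans (lerD h (lexx _)) _.
by move: se; rewrite ltr_pdivlMr // => /ltW; rewrite mulrDr mulr1 addrC.
Qed.

(** * Uniqueness and invariance for a field on a compact set *)

Section flow.
Context {R : realType} {m n : nat}.
Variables (K : set 'M[R]_(m, n)) (F : 'M[R]_(m, n) -> 'M[R]_(m, n)) (L : R).
Hypothesis L0 : 0 < L.
Hypothesis FL : forall a b, K a -> K b -> `|F a - F b| <= L * `|a - b|.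

(** Both solutions stay in [K], where [F] is Lipschitz, so the norm of their difference grows at a
    rate at most [L] times itself. *)
Lemma flow_unique (T : R) (y z : R -> 'M[R]_(m, n)) :
  y 0 = z 0 ->
  (forall t, 0 <= t < T -> K (y t) /\
     is_derive_within [set s | 0 <= s < T] y t (F (y t))) ->
  (forall t, 0 <= t < T -> K (z t) /\
     is_derive_within [set s | 0 <= s < T] z t (F (z t))) ->
  forall t, 0 <= t < T -> y t = z t.
Proof.
move=> yz0 hy hz t tT; apply/eqP; rewrite -subr_eq0 -normr_le0.
apply: (@dini_gronwall _ (fun t => `|y t - z t|) L T) => //; first exact: ltW.
- by rewrite yz0 subrr normr0.
- move=> {tT}t tT e e0.
  have e2 : 0 < e / 2 by rewrite divr_gt0.
  have [d1 d10 h1] := is_derive_within_dist_le (proj2 (hy t tT)) e2.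
  have [d2 d20 h2] := is_derive_within_dist_le (proj2 (hz t tT)) e2.
  exists (Num.min d1 d2); first by rewrite lt_min d10.
  move=> s sT; rewrite lt_min => /andP[/(h1 s sT) k1 /(h2 s sT) k2].
  apply: le_trans (ler_dist_dist _ _) _.
  have -> : y s - z s - (y t - z t) = (y s - y t) - (z s - z t).
    by apply/matrixP => i j; rewrite !mxE; ring.
  by apply: le_trans (ler_normB _ _) _; rewrite [leRHS]splitr lerD // distrC.
- move=> {tT}t tT e e0.
  have e2 : 0 < e / 2 by rewrite divr_gt0.
  have [Ky /is_derive_withinP/(_ _ e2)[d1 d10 h1]] := hy t tT.
  have [Kz /is_derive_withinP/(_ _ e2)[d2 d20 h2]] := hz t tT.
  exists (Num.min d1 d2); first by rewrite lt_min d10.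
  move=> s /andP[ts sth] sT.
  have Js : 0 <= s < T by rewrite sT andbT (le_trans _ (ltW ts)) //; case/andP: tT.
  have st0 : 0 <= s - t by rewrite subr_ge0 ltW.
  have := sth; rewrite -ltrBlDl => std.
  have : `|s - t| < Num.min d1 d2 by rewrite ger0_norm.
  rewrite lt_min => /andP[/(h1 s Js) k1 /(h2 s Js) k2].
  rewrite ger0_norm // in k1; rewrite ger0_norm // in k2.
  have -> : y s - z s = (y s - y t - (s - t) *: F (y t)) -
      (z s - z t - (s - t) *: F (z t)) + ((y t - z t) + (s - t) *: (F (y t) - F (z t))).
    by rewrite scalerBr; apply/matrixP => i j; rewrite !mxE; ring.
  apply: le_trans (ler_normD _ _) _.
  have k3 : `|y t - z t + (s - t) *: (F (y t) - F (z t))| <=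
      `|y t - z t| + (s - t) * (L * `|y t - z t|).
    apply: le_trans (ler_normD _ _) _; rewrite lerD2l normrZ ger0_norm //.
    by rewrite ler_wpM2l // FL.
  have := ler_normB (y s - y t - (s - t) *: F (y t)) (z s - z t - (s - t) *: F (z t)).
  by move: k1 k2 k3; rewrite [(s - t) * (_ + e)]mulrDr; lra.
Qed.

(* Nagumo: the distance to [K] of a solution of a Lipschitz extension satisfies
   a Gronwall inequality, since a nearest point of [K] can be moved inside [K]
   with the velocity prescribed there. *)
Lemma flow_exists (z0 : 'M[R]_(m, n)) : compact K -> K z0 ->
  (forall z, K z -> exists2 c : R -> 'M[R]_(m, n), c 0 = z &
     is_derive (0 : R) (1 : R) c (F z) /\
     exists2 e : R, 0 < e & forall s, 0 <= s < e -> K (c s)) ->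
  exists2 z : R -> 'M[R]_(m, n), z 0 = z0 &
    forall t, 0 <= t -> K (z t) /\ is_derive_within [set s | 0 <= s] z t (F (z t)).
Proof.
move=> cK Kz0 hK.
have K0 : K !=set0 by exists z0.
have [B FB] : exists B, forall a, K a -> `|F a| <= B.
  have [M [_ hM]] := compact_bounded cK.
  exists (`|F z0| + L * ((M + 1) + `|z0|)) => a Ka.
  have := FL Ka Kz0; have := ler_normD (F a - F z0) (F z0); rewrite subrK.
  have : `|a| <= M + 1 by apply: (hM (M + 1)) => //; rewrite ltrDl.
  move=> aM h1 h2; apply: le_trans h1 _; rewrite addrC lerD2l.
  apply: le_trans h2 _; rewrite ler_pM2l //.
  by apply: le_trans (ler_normB _ _) _; rewrite lerD2r.
have B0 : 0 <= B by apply: le_trans (FB _ Kz0).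
(* Each entry is extended separately; the norm being the maximum of the entries, the extension [H]
   keeps the constants [L] and [B]. *)
have /choice[G hG] : forall ij : 'I_m * 'I_n, exists G : 'M[R]_(m, n) -> R,
    [/\ forall a b, `|G a - G b| <= L * `|a - b|,
        forall a, `|G a| <= B & forall a, K a -> G a = F a ij.1 ij.2].
  move=> [i j]; apply: mcshane => //; first exact: ltW.
    move=> a b Ka Kb; apply: le_trans (FL Ka Kb).
    have -> : F a i j - F b i j = (F a - F b) i j by rewrite !mxE.
    exact: normmx_entry.
  by move=> a Ka; apply: le_trans (FB a Ka); exact: normmx_entry.
pose H a : 'M[R]_(m, n) := \matrix_(i, j) G (i, j) a.
have HL a b : `|H a - H b| <= L * `|a - b|.
  apply: normmx_le => [|i j]; first by rewrite mulr_ge0 // ltW.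
  by rewrite !mxE; have [+ _ _] := hG (i, j); exact.
have HB a : `|H a| <= B.
  by apply: normmx_le => // i j; rewrite !mxE; have [_ + _] := hG (i, j); exact.
have HF a : K a -> H a = F a.
  by move=> Ka; apply/matrixP => i j; rewrite mxE; have [_ _ ->] := hG (i, j).
have [z zz0 hz] := picard z0 L0 HL HB.
have /choice[p hp] : forall a : 'M[R]_(m, n), exists p, K p /\ forall w, K w -> `|a - p| <= `|a - w|.
  move=> a; have [|p /set_mem Kp hp] := @compact_EVT_min _ _ (fun w : 'M[R]_(m, n) => `|a - w|) K K0 cK.
    apply: continuous_subspaceT; apply: (@lipschitz_dist_continuous _ _ _ _ 1) => s t.
    rewrite mul1r; apply: le_trans (ler_dist_dist _ _) _.
    by rewrite opprB addrC subrKA distrC.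
  by exists p; split=> // w Kw; apply: hp; exact: mem_set.
pose d t := `|z t - p (z t)|.
have dle t w : K w -> d t <= `|z t - w| by have [_] := hp (z t); exact.
have Kp t : K (p (z t)) by have [] := hp (z t).
suff dT t : 0 <= t -> d t <= 0.
  exists z => // t t0; have := dT t t0; rewrite /d normr_le0 subr_eq0 => /eqP zp.
  have Kzt : K (z t) by rewrite zp.
  by split; rewrite -?(HF _ Kzt) //; exact: hz.
(* [dini_gronwall] works on a half-open interval, so [t] is placed inside [[0, t + 1)]. *)
move=> t0; have tt1 : 0 <= t < t + 1 by apply/andP; split; lra.
move: {t0}(t + 1) tt1 => T tT; apply: (@dini_gronwall _ d L T _ _ _ _ t tT).
- exact: ltW.
- by apply: le_trans (dle 0 z0 Kz0) _; rewrite zz0 subrr normr0.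
- move=> {t tT} t /andP[t0 _] e e0.
  have [h h0 hh] := is_derive_within_dist_le (hz t t0) e0.
  exists h => // s /andP[s0 _] st; have k := hh s s0 st.
  rewrite ler_norml; apply/andP; split.
    have := dle t _ (Kp s); have := ler_distD (z s) (z t) (p (z s)).
    by rewrite [`|z t - z s|]distrC /d; move: k; lra.
  have := dle s _ (Kp t); have := ler_distD (z t) (z s) (p (z t)).
  by rewrite /d; move: k; lra.
- move=> {t tT} t /andP[t0 _] e e0.
  have e2 : 0 < e / 2 by rewrite divr_gt0.
  have [c c0 [dc [r r0 cK']]] := hK _ (Kp t).
  have [d1 d10 h1] := is_derive_dist dc e2.
  have [d2 d20 h2] := (is_derive_withinP _ _ _ _).1 (hz t t0) _ e2.
  exists (Num.min r (Num.min d1 d2)); first by rewrite !lt_min r0 d10.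
  move=> s /andP[ts sth] _.
  have s0 : 0 <= s by rewrite (le_trans t0) // ltW.
  have st0 : 0 <= s - t by rewrite subr_ge0 ltW.
  have := sth; rewrite -ltrBlDl !lt_min => /and3P[sr sd1 sd2].
  have Kc : K (c (s - t)) by apply: cK'; rewrite st0.
  have := h1 (s - t); rewrite subr0 c0 ger0_norm // => /(_ sd1) k1.
  have := h2 s s0; rewrite ger0_norm // => /(_ sd2) k2.
  apply: le_trans (dle s _ Kc) _.
  (* Both motions are linearised at time [t]. Each error is at most [e / 2 * (s - t)]; the remaining
     drift is controlled by the Lipschitz constant of [H], which agrees with [F] at the nearest
     point. *)
  have -> : z s - c (s - t) = (z s - z t - (s - t) *: H (z t)) -
      (c (s - t) - p (z t) - (s - t) *: F (p (z t))) +
      ((z t - p (z t)) + (s - t) *: (H (z t) - H (p (z t)))).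
    by rewrite (HF (p _)) // scalerBr; apply/matrixP => i j; rewrite !mxE; ring.
  apply: le_trans (ler_normD _ _) _.
  have k3 : `|z t - p (z t) + (s - t) *: (H (z t) - H (p (z t)))| <=
      d t + (s - t) * (L * d t).
    apply: le_trans (ler_normD _ _) _; rewrite lerD2l normrZ ger0_norm //.
    by rewrite ler_wpM2l.
  have := ler_normB (z s - z t - (s - t) *: H (z t))
    (c (s - t) - p (z t) - (s - t) *: F (p (z t))).
  by move: k1 k2 k3; rewrite [(s - t) * (_ + e)]mulrDr; lra.
Qed.

End flow.

(** * Differential calculus *)

(** ['d] is a chosen linear map, so the equality has to come from uniqueness of the first-order
    expansion, which sees only values near [x]. *)
Lemma near_eq_diff {R : realType} {V W : normedModType R} (f g : V -> W) x :
  (\near x, f x = g x) -> differentiable f x ->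
  differentiable g x /\ 'd g x = 'd f x :> (V -> W).
Proof.
move=> fg df.
have [dc /eqaddoP hf] := (diff_locallyP x f).1 df.
have hg : g \o shift x = cst (g x) + 'd f x +o_ 0 id.
  apply/eqaddoP => e e0; have := hf e e0.
  have : \forall h \near 0, f (h + x) = g (h + x).
    have := fg; rewrite (near_shift 0) subr0 => h.
    by near=> y; near: y.
  apply: filterS2 => h /= fgh; have fgx : f x = g x by exact: (nbhs_singleton fg).
  by rewrite -[(_ - _) h]/(f (h + x) - (f x + 'd f x h)) fgh fgx.
have gd := diff_unique dc hg.
split; last exact: gd.
by apply/diff_locallyP; rewrite gd; split; [exact: dc|exact: hg].
Unshelve. all: by end_near. Qed.

Section Cr_on_theory.
Context {R : realType} {V : normedModType R}.
Implicit Types (U : set V) (r : nat).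

Lemma Cr_on_ext {W : normedModType R} r U (f g : V -> W) : open U ->
  (forall x, U x -> f x = g x) -> Cr_on r U f -> Cr_on r U g.
Proof.
move=> oU; have near_fg (f' g' : V -> W) x : (forall x, U x -> f' x = g' x) -> U x ->
    \near x, f' x = g' x.
  by move=> fg Ux; apply: filterS (open_nbhs_nbhs (conj oU Ux)).
elim: r f g => [|r IH] f g fg /=.
  move=> cf x Ux; have := cf x Ux; rewrite /prop_for /continuous_at (fg x Ux).
  by apply: cvg_trans; apply: near_eq_cvg; exact: near_fg.
move=> [df hf]; split=> [x Ux|v].
  by have [] := near_eq_diff (near_fg _ _ _ fg Ux) (df x Ux).
apply: IH (hf v) => x Ux.
by have [_ ->] := near_eq_diff (near_fg _ _ _ fg Ux) (df x Ux).
Qed.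

Lemma Cr_on_pred {W : normedModType R} r U (f : V -> W) :
  Cr_on r.+1 U f -> Cr_on r U f.
Proof.
elim: r f => [|r IH] f [df hf].
  by move=> x Ux; apply: differentiable_continuous; exact: df.
by split=> // v; apply: IH; exact: hf.
Qed.

Lemma Cr_on_cst {W : normedModType R} r U (a : W) : Cr_on r U (cst a : V -> W).
Proof.
elim: r a => [|r IH] a /=; first by move=> x _; exact: cst_continuous.
split=> [x _|v]; first exact: differentiable_cst.
rewrite (_ : (fun _ => _) = cst 0) //.
by apply/funext => x; rewrite diff_cst.
Qed.

Lemma Cr_on_add {W : normedModType R} r U (f g : V -> W) : open U ->
  Cr_on r U f -> Cr_on r U g -> Cr_on r U (fun x => f x + g x).
Proof.
move=> oU; elim: r f g => [|r IH] f g /=.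
  by move=> cf cg x Ux; apply: continuousD; [exact: cf|exact: cg].
move=> [df hf] [dg hg]; split=> [x Ux|v].
  by apply: differentiableD; [exact: df|exact: dg].
apply: Cr_on_ext (IH _ _ (hf v) (hg v)) => // x Ux.
exact: esym (congr1 (fun h => h v) (diffD (df x Ux) (dg x Ux))).
Qed.

Lemma Cr_on_mul r U (f g : V -> R) : open U ->
  Cr_on r U f -> Cr_on r U g -> Cr_on r U (fun x => f x * g x).
Proof.
move=> oU; elim: r f g => [|r IH] f g.
  by move=> cf cg x Ux; apply: continuousM; [exact: cf|exact: cg].
move=> f1 g1; have f0 := Cr_on_pred f1; have g0 := Cr_on_pred g1.
move: f1 g1 => [df hf] [dg hg]; split=> [x Ux|v].
  by apply: differentiableM; [exact: df|exact: dg].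
apply: Cr_on_ext (Cr_on_add oU (IH _ _ f0 (hg v)) (IH _ _ g0 (hf v))) => // x Ux.
exact: esym (congr1 (fun h => h v) (diffM (df x Ux) (dg x Ux))).
Qed.

Lemma Cr_on_inv r U (f : V -> R) : open U -> (forall x, U x -> f x != 0) ->
  Cr_on r U f -> Cr_on r U (fun x => (f x)^-1).
Proof.
move=> oU f0; elim: r f f0 => [|r IH] f f0.
  by move=> cf x Ux; apply: cvgV; [exact: f0|exact: cf].
move=> f1; have fr := IH _ f0 (Cr_on_pred f1).
move: f1 => [df hf]; split=> [x Ux|v].
  by apply: differentiableV; [exact: df|exact: f0].
have := Cr_on_mul oU (Cr_on_mul oU fr fr) (Cr_on_mul oU (Cr_on_cst r U (-1 : R)) (hf v)).
apply: (Cr_on_ext oU) => x Ux.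
have dv : 'd (fun y => (f y)^-1) x v = - (f x) ^- 2 * 'd f x v.
  have e := diffV (df x Ux) (f0 x Ux).
  transitivity ((- (f x) ^- 2 \*: 'd f x) v).
    exact: (congr1 (fun h : V -> R => h v) e).
  by [].
by rewrite dv mulN1r mulrN -invfM -expr2 -mulNr.
Qed.

Lemma diff_entry {m n} (f : V -> 'M[R]_(m, n)) x v i j : differentiable f x ->
  differentiable (fun y => f y i j : R) x /\
  'd (fun y => f y i j : R) x v = 'd f x v i j.
Proof.
move=> df.
have dc := @differentiable_coord R m n (f x) i j.
split; first exact: (differentiable_comp df dc).
rewrite -[LHS]/('d ((fun N : 'M[R]_(m, n) => N i j : R) \o f) x v).
rewrite (diff_comp df dc) /=.
have @l : {linear 'M[R]_(m, n) -> R}.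
  by exists (fun N : 'M[R]_(_, _) => N i j); do 2![eexists]; do ?[constructor];
     rewrite ?mxE// => ? *; rewrite ?mxE//; move=> ?; rewrite !mxE.
rewrite (_ : (fun _ => _) = l) // diff_lin //; exact: coord_continuous.
Qed.

Lemma Cr_on_entry {m n} r U (f : V -> 'M[R]_(m, n)) i j : open U ->
  Cr_on r U f -> Cr_on r U (fun y => f y i j : R).
Proof.
move=> oU; elim: r f => [|r IH] f /=.
  move=> cf x Ux; apply: (@continuous_comp _ _ _ f (fun N => N i j)).
    exact: cf.
  exact: coord_continuous.
move=> [df hf]; split=> [x Ux|v]; first by have [] := diff_entry x i j (df x Ux).
apply: Cr_on_ext (IH _ (hf v)) => // x Ux.
by have [_ ->] := diff_entry v i j (df x Ux).
Qed.

End Cr_on_theory.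

(* Function algebras: C^r functions, functions differentiable at a point and
   locally Lipschitz functions are handled uniformly. *)
Section function_algebra.
Context {R : fieldType} {T : Type}.

Definition fun_algebra (D : (T -> R) -> Prop) : Prop :=
  [/\ forall c, D (fun=> c),
      forall f g, D f -> D g -> D (fun x => f x + g x) &
      forall f g, D f -> D g -> D (fun x => f x * g x)].

Variable D : (T -> R) -> Prop.
Hypothesis hD : fun_algebra D.

Definition in_algebra {m n} (A : T -> 'M[R]_(m, n)) : Prop :=
  forall i j, D (fun x => A x i j).

Lemma in_algebra_cst {m n} (A : 'M[R]_(m, n)) : in_algebra (fun=> A).
Proof. by move=> i j; case: hD => h _ _; exact: h. Qed.

Lemma in_algebra_add {m n} (A B : T -> 'M[R]_(m, n)) :
  in_algebra A -> in_algebra B -> in_algebra (fun x => A x + B x).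
Proof.
move=> hA hB i j; case: hD => _ h _.
by under eq_fun do rewrite mxE; exact: h.
Qed.

Lemma in_algebra_scale {m n} (a : T -> R) (A : T -> 'M[R]_(m, n)) :
  D a -> in_algebra A -> in_algebra (fun x => a x *: A x).
Proof.
move=> ha hA i j; case: hD => _ _ h.
by under eq_fun do rewrite mxE; exact: h.
Qed.

Lemma in_algebra_opp {m n} (A : T -> 'M[R]_(m, n)) :
  in_algebra A -> in_algebra (fun x => - A x).
Proof.
move=> hA; under eq_fun do rewrite -scaleN1r.
by apply: in_algebra_scale => //; case: hD => h _ _; exact: h.
Qed.

Lemma in_algebra_tr {m n} (A : T -> 'M[R]_(m, n)) :
  in_algebra A -> in_algebra (fun x => (A x)^T).
Proof. by move=> hA i j; under eq_fun do rewrite mxE; exact: hA. Qed.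

Lemma algebra_sum {I : Type} (r : seq I) (P : pred I) (f : I -> T -> R) :
  (forall i, D (f i)) -> D (fun x => \sum_(i <- r | P i) f i x).
Proof.
move=> hf; case: hD => h1 h2 _; elim: r => [|i r IH].
  by under eq_fun do rewrite big_nil; exact: h1.
under eq_fun do rewrite big_cons.
by case: (P i) => //; exact: h2.
Qed.

Lemma algebra_prod {I : Type} (r : seq I) (P : pred I) (f : I -> T -> R) :
  (forall i, D (f i)) -> D (fun x => \prod_(i <- r | P i) f i x).
Proof.
move=> hf; case: hD => h1 _ h2; elim: r => [|i r IH].
  by under eq_fun do rewrite big_nil; exact: h1.
under eq_fun do rewrite big_cons.
by case: (P i) => //; exact: h2.
Qed.

Lemma in_algebra_mul {m n p} (A : T -> 'M[R]_(m, n)) (B : T -> 'M[R]_(n, p)) :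
  in_algebra A -> in_algebra B -> in_algebra (fun x => A x *m B x).
Proof.
move=> hA hB i j; under eq_fun do rewrite mxE.
by apply: algebra_sum => l; case: hD => _ _ h; exact: h.
Qed.

Lemma in_algebra_sum {m n} {I : Type} (r : seq I) (P : pred I)
    (A : I -> T -> 'M[R]_(m, n)) :
  (forall i, in_algebra (A i)) -> in_algebra (fun x => \sum_(i <- r | P i) A i x).
Proof.
move=> hA i j; under eq_fun do rewrite summxE.
by apply: algebra_sum => l; exact: hA.
Qed.

Lemma algebra_det {n} (A : T -> 'M[R]_n) :
  in_algebra A -> D (fun x => \det (A x)).
Proof.
move=> hA; apply: algebra_sum => s; case: hD => h _ hm.
by apply: (hm (fun=> _)); [exact: h|exact: algebra_prod].
Qed.

Lemma in_algebra_adj {n} (A : T -> 'M[R]_n) :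
  in_algebra A -> in_algebra (fun x => \adj (A x)).
Proof.
move=> hA i j; under eq_fun do rewrite mxE /cofactor.
case: hD => h _ hm; apply: (hm (fun=> _)); first exact: h.
by apply: algebra_det => i' j'; under eq_fun do rewrite !mxE; exact: hA.
Qed.

End function_algebra.

Lemma is_derive_comp_diff {R : realType} {V W : normedModType R} (c : R -> V)
    (h : V -> W) t w : is_derive t (1 : R) c w -> differentiable h (c t) ->
  is_derive t (1 : R) (h \o c) ('d h (c t) w).
Proof.
move=> [dc cw] dh; have dc' := (derivable1_diffP c t).1 dc.
have dhc := differentiable_comp dc' dh.
split; first by apply/derivable1_diffP.
by rewrite deriveE // (diff_comp dc' dh) /= -cw deriveE.
Qed.

Lemma is_derive_line {R : realType} {V : normedModType R} (a b : V) (t : R) :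
  is_derive t (1 : R) (fun s => a + s *: b) b.
Proof.
have -> : (fun s => a + s *: b) = cst a + (fun s => s *: b) by [].
have h : is_derive t (1 : R) (fun s => s *: b) b.
  have ds : is_diff t ( *:%R ^~ b : R -> V) ( *:%R ^~ b) by exact: is_diff_scalel.
  have d : differentiable (fun s : R => s *: b) t by case: ds.
  split; first by apply/derivable1_diffP.
  by rewrite deriveE //; case: ds => _ ->; rewrite scale1r.
by apply: is_derive_eq; rewrite add0r.
Qed.

Lemma MVT0 {R : realType} (f df : R -> R) (t : R) : 0 <= t ->
  (forall s, 0 <= s <= t -> is_derive s (1 : R) f (df s)) ->
  exists2 s, 0 <= s <= t & f t - f 0 = df s * t.
Proof.
move=> t0 hf.
have dfI s : s \in `]0, t[ -> is_derive s (1 : R) f (df s).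
  by rewrite in_itv /= => /andP[/ltW s0 /ltW st]; apply: hf; rewrite s0.
have cf : {within `[0, t], continuous f}.
  apply: derivable_within_continuous => s; rewrite in_itv /= => sI.
  by have [] := hf s sI.
have [s] := MVT_segment t0 dfI cf.
by rewrite in_itv /= subr0 => sI fE; exists s.
Qed.

(** * Symmetry of second derivatives *)

Section schwarz.
Context {R : realType} {V : normedModType R}.
Variables (U : set V) (g : V -> R) (x : V).
Hypotheses (oU : open U) (g2 : Cr_on 2 U g).

(** The mean value theorem is used twice: on the difference across [t *: v] as a function of the
    step along [u], then on the derivative along [u] as a function of the step along [v]. *)
Let double_difference (u v : V) (t : R) : 0 < t ->
  (forall s r, 0 <= s <= t -> 0 <= r <= t -> U (x + s *: u + r *: v)) ->
  exists s r, [/\ 0 <= s <= t, 0 <= r <= t &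
    g (x + t *: u + t *: v) - g (x + t *: u) - (g (x + t *: v) - g x) =
    t ^+ 2 * 'd (fun y => 'd g y u) (x + s *: u + r *: v) v].
Proof.
move=> t0 hU; have [dg dg1] := g2; have [dgu _] := dg1 u.
have U0 s : 0 <= s <= t -> U (x + s *: u).
  by move=> st; have := hU s 0 st; rewrite scale0r addr0 lexx ltW //; apply.
have tt : 0 <= t <= t by rewrite lexx ltW.
pose f s := g ((x + t *: v) + s *: u) - g (x + s *: u).
have df s : 0 <= s <= t -> is_derive s (1 : R) f
    ('d g ((x + t *: v) + s *: u) u - 'd g (x + s *: u) u).
  move=> st; apply: is_deriveB.
    apply: (is_derive_comp_diff (is_derive_line (x + t *: v) u s)).
    by apply: dg; rewrite addrAC; exact: hU.
  by apply: (is_derive_comp_diff (is_derive_line x u s)); apply: dg; exact: U0.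
have [s sI fE] := MVT0 (ltW t0) df.
pose h r := 'd g ((x + s *: u) + r *: v) u.
have dh r : 0 <= r <= t -> is_derive r (1 : R) h
    ('d (fun y => 'd g y u) ((x + s *: u) + r *: v) v).
  move=> rt; apply: (is_derive_comp_diff (h := fun y => 'd g y u)
    (is_derive_line (x + s *: u) v r)).
  by apply: dgu; exact: hU.
have [r rI hE] := MVT0 (ltW t0) dh; exists s, r; split => //.
move: fE hE; rewrite /f /h !scale0r !addr0 => fE hE.
rewrite [x + t *: u + t *: v]addrAC.
by rewrite fE [x + t *: v + s *: u]addrAC hE; ring.
Qed.

(** The double difference is symmetric in [u] and [v], so the two mixed derivatives agree at two
    points close to [x]; their continuity at [x] closes the gap. *)
Lemma diff2_sym (u v : V) : U x ->
  'd (fun y => 'd g y u) x v = 'd (fun y => 'd g y v) x u.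
Proof.
move=> Ux; have [dg dg1] := g2.
pose A := fun y => 'd (fun y => 'd g y u) y v.
pose B := fun y => 'd (fun y => 'd g y v) y u.
have cA : {for x, continuous A} by have [_ h] := dg1 u; exact: h.
have cB : {for x, continuous B} by have [_ h] := dg1 v; exact: h.
rewrite -/(A x) -/(B x); apply/eqP; rewrite -subr_eq0 -normr_le0.
apply/ler_addgt0Pl => e e0; rewrite addr0.
have e2 : 0 < e / 2 by rewrite divr_gt0.
have nA := (cvgrPdist_le _ _).1 cA _ e2; have nB := (cvgrPdist_le _ _).1 cB _ e2.
have /nbhs_ballP[d /= d0 hd] : \forall y \near x,
    [/\ U y, `|A x - A y| <= e / 2 & `|B x - B y| <= e / 2].
  near=> y; split; near: y; [|exact: nA|exact: nB].
  exact: open_nbhs_nbhs (conj oU Ux).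
pose N := `|u| + `|v| + 1.
have N0 : 0 < N by rewrite ltr_wpDl // addr_ge0.
(* Displacements with both steps at most [t] have norm at most [d / 2]; the [+ 1] in [N] keeps it
   positive when [u] and [v] vanish. *)
pose t := d / 2 / N.
have t0 : 0 < t by rewrite !divr_gt0.
have hball s r u' v' : `|u'| + `|v'| = `|u| + `|v| -> 0 <= s <= t -> 0 <= r <= t ->
    ball x d (x + s *: u' + r *: v').
  move=> uv /andP[s0 st] /andP[r0 rt]; rewrite -ball_normE /ball_ /= -addrA opprD addNKr.
  rewrite normrN; apply: le_lt_trans (ler_normD _ _) _; rewrite !normrZ !ger0_norm //.
  apply: (@le_lt_trans _ _ (t * N)); last by rewrite /t divfK ?gt_eqF //; lra.
  rewrite /N -uv !mulrDr mulr1 -addrA lerD // ?ler_wpM2r // ler_wpDr ?ler_wpM2r //.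
  exact: ltW.
have [|s1 [r1 [s1t r1t E1]]] := @double_difference u v t t0.
  by move=> s r st rt; have [] := hd _ (hball s r u v erefl st rt).
have vu : `|v| + `|u| = `|u| + `|v| by rewrite addrC.
have [|s2 [r2 [s2t r2t E2]]] := @double_difference v u t t0.
  by move=> s r st rt; have [] := hd _ (hball s r v u vu st rt).
have AB : A (x + s1 *: u + r1 *: v) = B (x + s2 *: v + r2 *: u).
  apply: (mulfI (x := t ^+ 2)); first by rewrite expf_neq0 // gt_eqF.
  by rewrite -E1 -E2 [x + t *: v + t *: u]addrAC; ring.
have [_ a1 _] := hd _ (hball s1 r1 u v erefl s1t r1t).
have [_ _ b1] := hd _ (hball s2 r2 v u vu s2t r2t).
rewrite AB in a1; have := ler_distD (B (x + s2 *: v + r2 *: u)) (A x) (B x).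
by move: a1 b1; rewrite [`|B x - _|]distrC; lra.
Unshelve. all: by end_near. Qed.

End schwarz.

Lemma fun_algebra_Cr_on {R : realType} {V : normedModType R} r (U : set V) :
  open U -> fun_algebra (Cr_on r U : (V -> R) -> Prop).
Proof.
move=> oU; split; first exact: Cr_on_cst.
- by move=> f g; exact: Cr_on_add.
- by move=> f g; exact: Cr_on_mul.
Qed.

Definition Cr_mx {R : realType} {V : normedModType R} {m n} r (U : set V)
    (A : V -> 'M[R]_(m, n)) : Prop := in_algebra (Cr_on r U : (V -> R) -> Prop) A.

Lemma fun_algebra_differentiable {R : realType} {V : normedModType R} (x : V) :
  fun_algebra (fun f : V -> R => differentiable f x).
Proof.
split; first by move=> c; exact: differentiable_cst.
- by move=> f g; exact: differentiableD.
- by move=> f g; exact: differentiableM.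
Qed.

(** * Locally Lipschitz functions on a compact set *)

Section locally_lipschitz.
Context {R : realType} {E : normedModType R}.
Implicit Types (K : set E) (z : E) (g : E -> R).

(** Only pairs in [K] are compared, because the field has its intended values on the bundle
    alone. *)
Definition locally_lipschitz K z g : Prop :=
  exists L e : R, [/\ 0 <= L, 0 < e &
    forall a b, K a -> K b -> ball z e a -> ball z e b ->
      `|g a - g b| <= L * `|a - b|].

(** [K z] serves the product: comparison with the value at [z] bounds both factors nearby. *)
Lemma fun_algebra_locally_lipschitz K z : K z ->
  fun_algebra (locally_lipschitz K z).
Proof.
move=> Kz; split.
- move=> c; exists 0, 1; split => // a b _ _ _ _.
  by rewrite subrr normr0 mul0r.
- move=> f g [L [e [L0 e0 hf]]] [M [d [M0 d0 hg]]].
  exists (L + M), (Num.min e d); split; [exact: addr_ge0|by rewrite lt_min e0|].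
  move=> a b Ka Kb za zb.
  have le1 : Num.min e d <= e by rewrite ge_min lexx.
  have le2 : Num.min e d <= d by rewrite ge_min lexx orbT.
  have h1 := hf a b Ka Kb (le_ball le1 za) (le_ball le1 zb).
  have h2 := hg a b Ka Kb (le_ball le2 za) (le_ball le2 zb).
  rewrite opprD addrACA mulrDl; apply: le_trans (ler_normD _ _) _.
  exact: lerD.
- move=> f g [L [e [L0 e0 hf]]] [M [d [M0 d0 hg]]].
  pose r := Num.min e d.
  have le1 : r <= e by rewrite ge_min lexx.
  have le2 : r <= d by rewrite ge_min lexx orbT.
  have r0 : 0 < r by rewrite lt_min e0.
  have bnd (h : E -> R) N : 0 <= N ->
      (forall a b, K a -> K b -> ball z r a -> ball z r b ->
        `|h a - h b| <= N * `|a - b|) ->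
      forall a, K a -> ball z r a -> `|h a| <= `|h z| + N * r.
    move=> N0 hh a Ka za; have := hh a z Ka Kz za (ballxx _ r0).
    have := ler_normD (h a - h z) (h z); rewrite subrK.
    have := za; rewrite -ball_normE /= distrC => /ltW az h1 h2.
    apply: le_trans h1 _; rewrite addrC lerD2l; apply: le_trans h2 _.
    exact: ler_wpM2l.
  have hf' a b : K a -> K b -> ball z r a -> ball z r b -> `|f a - f b| <= L * `|a - b|.
    by move=> Ka Kb /(le_ball le1) za /(le_ball le1); exact: hf.
  have hg' a b : K a -> K b -> ball z r a -> ball z r b -> `|g a - g b| <= M * `|a - b|.
    by move=> Ka Kb /(le_ball le2) za /(le_ball le2); exact: hg.
  pose Bf := `|f z| + L * r; pose Bg := `|g z| + M * r.
  have Bf0 : 0 <= Bf by rewrite addr_ge0 // mulr_ge0 // ltW.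
  have Bg0 : 0 <= Bg by rewrite addr_ge0 // mulr_ge0 // ltW.
  exists (Bf * M + Bg * L), r; split => //; first by rewrite addr_ge0 // mulr_ge0.
  move=> a b Ka Kb za zb.
  have -> : f a * g a - f b * g b = f a * (g a - g b) + g b * (f a - f b) by ring.
  rewrite mulrDl; apply: le_trans (ler_normD _ _) _; rewrite !normrM -!mulrA.
  by apply: lerD; apply: ler_pM => //; [exact: bnd hf' _ _ _|exact: hg'
    |exact: bnd hg' _ _ _|exact: hf'].
Qed.

Lemma locally_lipschitz_ext K z f g :
  (\near z, K z -> f z = g z) ->
  locally_lipschitz K z f -> locally_lipschitz K z g.
Proof.
move=> /nbhs_ballP[d /= d0 hd] [L [e [L0 e0 hf]]].
exists L, (Num.min e d); split => //; first by rewrite lt_min e0.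
move=> a b Ka Kb za zb.
have le1 : Num.min e d <= e by rewrite ge_min lexx.
have le2 : Num.min e d <= d by rewrite ge_min lexx orbT.
rewrite -(hd a (le_ball le2 za) Ka) -(hd b (le_ball le2 zb) Kb).
by apply: hf => //; exact: (le_ball le1).
Qed.

(** [K] need not be convex, so local constants cannot be chained along segments. For pairs closer
    than [L^-1] compactness makes the local constants uniform; for the others
    [|g a - g b| <= 2 M <= 2 M L |a - b|], with [M] a bound for [|g|]. *)
Lemma compact_locally_lipschitz K g : compact K ->
  (forall z, K z -> locally_lipschitz K z g) ->
  exists2 L, 0 < L & forall a b, K a -> K b -> `|g a - g b| <= L * `|a - b|.
Proof.
move=> cK hg.
have cov : near_covering_within K.
  by apply/near_covering_withinP; exact: (compact_near_coveringP K).1.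
have pick (Q : R -> Prop) : (\forall l \near +oo, Q l) -> exists l, 0 < l /\ Q l.
  move=> h; near (pinfty_nbhs R) => l; exists l; split.
    by near: l; exact: nbhs_pinfty_gt.
  by near: l; exact: h.
(* A single number is both Lipschitz constant and inverse radius, so the covering argument has just
   one eventual statement to make uniform. *)
have [L [L0 hL]] : exists L, 0 < L /\ K `<=` [set a | forall b, K b ->
    `|a - b| < L^-1 -> `|g a - g b| <= L * `|a - b|].
  apply: pick; apply: cov => z /hg[L [e [L0 e0 hL]]].
  exists (ball z (e / 2), [set l | Num.max L (2 / e) < l]) => /=.
    by split; [apply: nbhsx_ballx; rewrite divr_gt0|apply: nbhs_pinfty_gt; exact: num_real].
  move=> [a l] /= [za]; rewrite gt_max => /andP[Ll el] Ka b Kb ab.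
  have l0 : 0 < l by apply: le_lt_trans L0 Ll.
  have abe : `|a - b| < e / 2.
    apply: lt_trans ab _; rewrite -[e / 2]invrK ltf_pV2 ?posrE ?invr_gt0 ?divr_gt0 //.
    by rewrite invf_div.
  have zb : ball z e b.
    rewrite [e]splitr; apply: ball_triangle za _.
    by rewrite -ball_normE.
  have za' : ball z e a by apply: le_ball za; rewrite ler_pdivrMr //; lra.
  by apply: le_trans (hL a b Ka Kb za' zb) _; rewrite ler_wpM2r // ltW.
have [M [M0 hM]] : exists M, 0 < M /\ K `<=` [set a | `|g a| <= M].
  apply: pick; apply: cov => z Kz; have [N [e [N0 e0 hN]]] := hg z Kz.
  exists (ball z e, [set l | `|g z| + N * e < l]) => /=.
    by split; [exact: nbhsx_ballx|apply: nbhs_pinfty_gt; exact: num_real].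
  move=> [a l] /= [za /ltW zl] Ka; apply: le_trans zl.
  have := hN a z Ka Kz za (ballxx _ e0).
  have := ler_normD (g a - g z) (g z); rewrite subrK.
  have := za; rewrite -ball_normE /= distrC => /ltW az h1 h2.
  apply: le_trans h1 _; rewrite addrC lerD2l; apply: le_trans h2 _.
  exact: ler_wpM2l.
exists (Num.max L (2 * M * L)); first by rewrite lt_max L0.
move=> a b Ka Kb; have [ab|ab] := ltP `|a - b| L^-1.
  by apply: le_trans (hL a Ka b Kb ab) _; rewrite ler_wpM2r // le_max lexx.
apply: (@le_trans _ _ (2 * M)).
  apply: le_trans (ler_normB _ _) _; rewrite mulr_natl mulr2n.
  by apply: lerD; [exact: hM Ka|exact: hM Kb].
apply: (@le_trans _ _ (2 * M * L * `|a - b|)).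
  rewrite -mulrA ler_peMr //; first by rewrite mulr_ge0 // ltW.
  by rewrite -ler_pdivrMl // mulr1.
by rewrite ler_wpM2r // le_max lexx orbT.
Unshelve. all: by end_near. Qed.

End locally_lipschitz.

Lemma linear_cV {R : realType} {n} {W : lmodType R} (l : {linear 'cV[R]_n -> W}) u :
  l u = \sum_i u i 0 *: l (delta_mx i 0).
Proof.
rewrite {1}[u]matrix_sum_delta linear_sum; apply: eq_bigr => i _.
by rewrite big_ord1 linearZ.
Qed.

(** Mean value theorem along the segment from [b] to [a], which stays in a ball where the absolute
    value of each partial derivative exceeds its value at [x] by at most 1. *)
Lemma Cr_on1_lipschitz {R : realType} {n} (U : set 'cV[R]_n) (h : 'cV[R]_n -> R) x :
  open U -> U x -> Cr_on 1 U h ->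
  exists L e : R, [/\ 0 <= L, 0 < e &
    forall a b, ball x e a -> ball x e b -> `|h a - h b| <= L * `|a - b|].
Proof.
move=> oU Ux [dh ch].
pose D l := fun y => 'd h y (delta_mx l 0).
have nD l : \forall y \near x, `|D l y| <= `|D l x| + 1.
  have h0 : \forall y \near x, `|D l x - D l y| <= 1.
    by apply: (cvgrPdist_le _ _).1 (ch (delta_mx l 0) x Ux) _ ltr01.
  apply: filterS h0 => y h1.
  have := ler_normB (D l x) (D l x - D l y); rewrite subKr => h2.
  by apply: le_trans h2 _; rewrite lerD2l.
have /nbhs_ballP[e /= e0 he] : \forall y \near x,
    U y /\ forall l, `|D l y| <= `|D l x| + 1.
  near=> y; split; near: y; first exact: open_nbhs_nbhs (conj oU Ux).
  exact: filter_forall.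
exists (\sum_l (`|D l x| + 1)), e; split => //.
  by apply: sumr_ge0 => l _; rewrite addr_ge0.
move=> a b xa xb.
have seg (s : R) : 0 <= s <= 1 -> ball x e (b + s *: (a - b)).
  move=> /andP[s0 s1]; move: xa xb; rewrite -!ball_normE /= => xa xb.
  have -> : x - (b + s *: (a - b)) = s *: (x - a) + (1 - s) *: (x - b).
    by apply/matrixP => i j; rewrite !mxE; ring.
  apply: le_lt_trans (ler_normD _ _) _; rewrite !normrZ !ger0_norm ?subr_ge0 //.
  have := s0; rewrite le_eqVlt => /predU1P[<-|s0'].
    by rewrite mul0r add0r subr0 mul1r.
  have -> : e = s * e + (1 - s) * e by ring.
  by rewrite ltr_leD ?ltr_pM2l // ler_wpM2l ?subr_ge0 // ltW.
have dl (s : R) : 0 <= s <= 1 -> is_derive s (1 : R) (h \o (fun s : R => b + s *: (a - b)))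
    ('d h (b + s *: (a - b)) (a - b)).
  move=> s01; apply: is_derive_comp_diff; first exact: is_derive_line.
  by apply: dh; have [] := he _ (seg s s01).
have [s s01] := MVT0 ler01 dl.
rewrite /= scale1r scale0r addr0 mulr1 [b + _]addrC subrK => ->.
rewrite linear_cV.
apply: le_trans (ler_norm_sum _ _ _) _; rewrite mulr_suml; apply: ler_sum => l _.
rewrite normrM mulrC; apply: ler_pM => //; last exact: normmx_entry.
by have [_ ->] := he _ (seg s s01).
Unshelve. all: by end_near. Qed.

(** * Tangent projectors of an embedded submanifold *)

Lemma unitmx_ker0 {F : fieldType} {n} (A : 'M[F]_n) :
  (forall v : 'cV[F]_n, A *m v = 0 -> v = 0) -> A \in unitmx.
Proof.
move=> kA; rewrite -unitmx_tr -row_free_unit -kermx_eq0; apply/eqP/matrixP => i j.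
have h : A *m (row i (kermx A^T))^T = 0.
  by apply: trmx_inj; rewrite trmx_mul trmxK -row_mul mulmx_ker row0 trmx0.
by have /colP/(_ j) := kA _ h; rewrite !mxE.
Qed.

(* [N] may have vanishing rows; adding the projector [E] onto them makes its
   Gram matrix invertible. *)
Lemma kernel_projector {R : realType} {n} (N E : 'M[R]_n)
    (G := N *m N^T + E) (P := 1%:M - N^T *m invmx G *m N) :
  E^T = E -> E *m E = E -> E *m N = 0 ->
  (forall v : 'cV[R]_n, N^T *m v = 0 -> E *m v = 0 -> v = 0) ->
  [/\ G \in unitmx, P^T = P, P *m P = P, N *m P = 0 &
      forall v : 'cV[R]_n, N *m v = 0 -> P *m v = v].
Proof.
move=> ET EE EN NE0.
have NE : N^T *m E = 0 by rewrite -[in LHS]ET -trmx_mul EN trmx0.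
have uG : G \in unitmx.
  apply: unitmx_ker0 => v Gv.
  have : dot (N^T *m v) (N^T *m v) + dot (E *m v) (E *m v) = 0.
    rewrite !dot_mull trmxK ET mulmxA [E *m (E *m v)]mulmxA EE.
    transitivity ((v^T *m (G *m v)) 0 0); last by rewrite Gv mulmx0 mxE.
    by rewrite mulmxDl mulmxDr [RHS]mxE.
  move/eqP; rewrite paddr_eq0 ?dot_ge0 // => /andP[/eqP/dot_eq0 Nv /eqP/dot_eq0 Ev].
  exact: NE0.
have GT : G^T = G by rewrite linearD /= trmx_mul trmxK ET.
have GE : G *m E = E by rewrite mulmxDl -mulmxA NE mulmx0 add0r.
have G'E : invmx G *m E = E by rewrite -[X in _ *m X = _]GE mulKmx.
have EG' : E *m invmx G = E by rewrite -[LHS]trmxK trmx_mul ET trmx_inv GT G'E ET.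
(* [N N^T G^-1 = (G - E) G^-1 = 1 - E], and [E] disappears because [E N = 0]. *)
have NP : N *m P = 0.
  rewrite mulmxBr mulmx1 !mulmxA.
  have -> : N *m N^T = G - E by rewrite addrK.
  by rewrite mulmxBl mulmxV // EG' mulmxBl mul1mx EN subr0 subrr.
split => //.
- by rewrite linearB /= trmx1 !trmx_mul trmxK trmx_inv GT mulmxA.
- transitivity (P - N^T *m invmx G *m (N *m P)); last by rewrite NP mulmx0 subr0.
  by rewrite mulmxA -[X in X - _]mul1mx -mulmxBl.
- by move=> v Nv; rewrite mulmxBl mul1mx -(mulmxA _ N v) Nv mulmx0 subr0.
Qed.

Section dmx.
Context {R : realType} {V : normedModType R}.

Definition dmx {m n} (A : V -> 'M[R]_(m, n)) (y u : V) : 'M[R]_(m, n) :=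
  \matrix_(i, j) 'd (fun z => A z i j : R) y u.

Definition mx_differentiable {m n} (A : V -> 'M[R]_(m, n)) (y : V) : Prop :=
  in_algebra (fun f : V -> R => differentiable f y) A.

Lemma dmx_mul {m n p} (A : V -> 'M[R]_(m, n)) (B : V -> 'M[R]_(n, p)) y u :
  mx_differentiable A y -> mx_differentiable B y ->
  dmx (fun z => A z *m B z) y u = dmx A y u *m B y + A y *m dmx B y u.
Proof.
move=> dA dB; apply/matrixP => i j; rewrite !mxE -big_split /=.
have -> : (fun z => (A z *m B z) i j) =
    \sum_(l < n) ((fun z => A z i l) * (fun z => B z l j)).
  by apply/funext => z; rewrite mxE fct_sumE.
have ds (l : 'I_n) : is_diff y ((fun z => A z i l) * (fun z => B z l j))
    (fun u => 'd (fun z => A z i l : R) y u * B y l j + A y i l * 'd (fun z => B z l j : R) y u).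
  have d1 := differentiableP (dA i l); have d2 := differentiableP (dB l j).
  by apply: is_diff_eq; apply/funext => v; rewrite addrC mulrC.
have dsum : is_diff y (\sum_(l < n) ((fun z => A z i l) * (fun z => B z l j)))
    (\sum_(l < n) (fun u => 'd (fun z => A z i l : R) y u * B y l j +
       A y i l * 'd (fun z => B z l j : R) y u)).
  elim/big_ind2 : _ => [|f df g dg hf hg|l _]; [exact: is_diff_cst|exact: is_diffD|exact: ds].
rewrite diff_val fct_sumE; apply: eq_bigr => l _.
by rewrite !mxE.
Qed.

Lemma dmx_add {m n} (A B : V -> 'M[R]_(m, n)) y u : mx_differentiable A y -> mx_differentiable B y ->
  dmx (fun z => A z + B z) y u = dmx A y u + dmx B y u.
Proof.
move=> dA dB; apply/matrixP => i j; rewrite !mxE.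
have -> : (fun z => (A z + B z) i j) = (fun z => A z i j) + (fun z => B z i j).
  by apply/funext => z; rewrite mxE.
exact: (congr1 (fun h : V -> R => h u) (diffD (dA i j) (dB i j))).
Qed.

Lemma near_eq_dmx {m n} (A B : V -> 'M[R]_(m, n)) y u : mx_differentiable A y ->
  (\near y, A y = B y) -> dmx A y u = dmx B y u.
Proof.
move=> dA AB; apply/matrixP => i j; rewrite !mxE.
have ABij : \near y, A y i j = B y i j by apply: filterS AB => z ->.
by have [_ ->] := near_eq_diff ABij (dA i j).
Qed.

Lemma dmx_tr {m n} (A : V -> 'M[R]_(m, n)) y u :
  dmx (fun z => (A z)^T) y u = (dmx A y u)^T.
Proof.
apply/matrixP => i j.
have e : (fun z => (A z)^T i j) = (fun z => A z j i).
  by apply/funext => z; rewrite mxE.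
by rewrite mxE e [RHS]mxE [RHS]mxE.
Qed.

Lemma is_derive_dmx {m n} (A : V -> 'M[R]_(m, n)) (c : R -> V) t u :
  mx_differentiable A (c t) -> is_derive t (1 : R) c u ->
  is_derive t (1 : R) (A \o c) (dmx A (c t) u).
Proof.
move=> dA dc; apply: is_derive_mx => i j; rewrite mxE.
exact: (is_derive_comp_diff (h := fun z => A z i j : R) dc (dA i j)).
Qed.

End dmx.

Lemma Cr_on_line {R : realType} {V W : normedModType R} r (U : set V) (B : set R)
    (g : V -> W) (a b : V) : open B -> (forall t, B t -> U (a + t *: b)) ->
  Cr_on r U g -> Cr_on r B (fun t => g (a + t *: b)).
Proof.
move=> oB hB.
have dl t := is_derive_line a b t.
elim: r g => [|r IH] g.
  move=> cg t Bt; apply: (@continuous_comp _ _ _ (fun t : R => a + t *: b) g).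
    by apply: differentiable_continuous; apply/derivable1_diffP; case: (dl t).
  by apply: cg; exact: hB.
move=> [dg hg]; have dgl t (Bt : B t) := is_derive_comp_diff (dl t) (dg _ (hB t Bt)).
have df (t : R) : B t -> differentiable (fun t : R => g (a + t *: b)) t.
  by move=> Bt; apply/derivable1_diffP; case: (dgl t Bt).
split=> // v; apply: (Cr_on_ext oB _ (IH _ (hg (v *: b)))) => t Bt.
have [_ e] := dgl t Bt; rewrite deriveE in e; last exact: df.
rewrite linearZ -e -[LHS]linearZ; congr ('d _ _ _).
by rewrite [LHS]mulr1.
Qed.

Section tangent_curve.
Context {R : realType} {n : nat}.
Variable M : set 'cV[R]_n.

Lemma curve_through_near x u c (U : set 'cV[R]_n) : curve_through M x u c ->
  open U -> U x -> \forall t \near (0 : R), U (c t) /\ M (c t).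
Proof.
move=> [[e e0 [_ hM]] c0 [dc _]] oU Ux.
have cc : {for 0, continuous c}.
  exact/differentiable_continuous/derivable1_diffP.
near=> t; split; near: t.
  by apply: cc; rewrite c0; exact: open_nbhs_nbhs (conj oU Ux).
by apply: filterS (nbhsx_ballx (0 : R) e e0) => t; exact: hM.
Unshelve. all: by end_near. Qed.

(** Tangency provides at least one curve, and uniqueness of the derivative along it pins down the
    value chosen by [get]. *)
Lemma mdiff_eq {W : normedModType R} (F : 'cV[R]_n -> W) x u w :
  tangent M x u ->
  (forall c, curve_through M x u c -> is_derive (0 : R) (1 : R) (F \o c) w) ->
  mdiff M F x u = w.
Proof.
move=> [c hc] hw; rewrite /mdiff; set S := (X in get X).
have Sw : S (get S) by apply: getPex; exists w; exact: hw.
by have [_ <-] := Sw c hc; have [_ <-] := hw c hc.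
Qed.

(** A curve of [M] sees only the values of [F] on [M], so any extension [G] differentiable at [x]
    computes the derivative. *)
Lemma is_derive_mdiff_mx {m p} (F G : 'cV[R]_n -> 'M[R]_(m, p)) x u (U : set 'cV[R]_n) :
  open U -> U x -> (forall y, U y -> M y -> F y = G y) -> mx_differentiable G x ->
  forall c, curve_through M x u c ->
  is_derive (0 : R) (1 : R) (F \o c) (dmx G x u).
Proof.
move=> oU Ux FG dG c hc; have [_ c0 dc] := hc.
have dGc : is_derive (0 : R) (1 : R) (G \o c) (dmx G x u).
  by rewrite -c0; apply: is_derive_dmx => //; rewrite c0.
apply: near_eq_is_derive dGc.
by apply: filterS (curve_through_near hc oU Ux) => t [Ut Mt]; rewrite /= FG.
Qed.

Lemma mdiff_mx {m p} (F G : 'cV[R]_n -> 'M[R]_(m, p)) x u (U : set 'cV[R]_n) :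
  open U -> U x -> (forall y, U y -> M y -> F y = G y) -> mx_differentiable G x ->
  tangent M x u -> mdiff M F x u = dmx G x u.
Proof.
by move=> oU Ux FG dG tu; apply: mdiff_eq => // c; exact: is_derive_mdiff_mx FG dG c.
Qed.

End tangent_curve.

Lemma pid_mx_mulE {R : nzRingType} {n p} d (B : 'M[R]_(n, p)) i j :
  ((pid_mx d : 'M[R]_n) *m B) i j = if (i < d)%N then B i j else 0.
Proof.
rewrite mxE (bigD1 i) //= mxE eqxx /= big1 => [|l li].
  by case: ifP; rewrite ?mul1r ?mul0r addr0.
by rewrite mxE; case: eqVneq => [/val_inj e|]; rewrite ?mul0r //; rewrite e eqxx in li.
Qed.

Section chart.
Context {R : realType} {n : nat}.
Variables (d : nat) (M U : set 'cV[R]_n) (phi psi : 'cV[R]_n -> 'cV[R]_n).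
Hypothesis dn : (d <= n)%N.
Hypotheses (oU : open U) (sphi : smooth_on U phi).
Hypotheses (oV : open (phi @` U)) (spsi : smooth_on (phi @` U) psi).
Hypothesis psiK : forall y, U y -> psi (phi y) = y.
Hypothesis Mphi : forall y, U y ->
  (M y <-> forall i : 'I_n, (d <= i)%N -> phi y i 0 = 0).

Let phi_i (i : 'I_n) (y : 'cV[R]_n) : R := phi y i 0.

(** The rows of index at least [d] are the differentials of the functions that define [M]; the
    others are set to zero rather than removed, which keeps the matrix square. *)
Definition normal_mx (y : 'cV[R]_n) : 'M[R]_n :=
  \matrix_(i, j) if (i < d)%N then 0 else 'd (phi_i i) y (delta_mx j 0).

Definition gram y := normal_mx y *m (normal_mx y)^T + pid_mx d.

(** The inverse of the Gram matrix is written by Cramer's rule, so that regularity follows from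
    sums, products and one scalar inverse. *)
Definition chart_tproj (y : 'cV[R]_n) : 'M[R]_n :=
  1%:M - (normal_mx y)^T *m ((\det (gram y))^-1 *: \adj (gram y)) *m normal_mx y.

Let dphi y : U y -> differentiable phi y.
Proof. by move=> Uy; have [h _] := sphi 1; exact: h. Qed.

Lemma chart_diffK y v : U y -> 'd psi (phi y) ('d phi y v) = v.
Proof.
move=> Uy; have dpsi : differentiable psi (phi y).
  by have [h _] := spsi 1; apply: h; exists y.
have e := diff_comp (dphi Uy) dpsi.
have Uid : \near y, id y = (psi \o phi) y.
  by apply: filterS (open_nbhs_nbhs (conj oU Uy)) => z Uz; rewrite /= psiK.
have [dI eI] : is_diff y (id : 'cV[R]_n -> 'cV[R]_n) id by exact: is_diff_id.
have [_ e'] := near_eq_diff Uid dI.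
have -> : 'd psi (phi y) ('d phi y v) = ('d psi (phi y) \o 'd phi y) v by [].
by rewrite -e e' eI.
Qed.

Let diff_phi_i i y v : U y -> 'd (phi_i i) y v = ('d phi y v) i 0.
Proof. by move=> Uy; have [_ ->] := diff_entry v i 0 (dphi Uy). Qed.

Let phi_iE i y (v : 'cV[R]_n) :
  'd (phi_i i) y v = \sum_j v j 0 * 'd (phi_i i) y (delta_mx j 0).
Proof. by rewrite linear_cV. Qed.

Lemma normal_mxE y (v : 'cV[R]_n) i : U y ->
  (normal_mx y *m v) i 0 = if (i < d)%N then 0 else ('d phi y v) i 0.
Proof.
move=> Uy; rewrite mxE; case: ifP => id.
  by rewrite big1 // => j _; rewrite mxE id mul0r.
rewrite -diff_phi_i // phi_iE; apply: eq_bigr => j _.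
by rewrite mxE id mulrC.
Qed.

(** Stated on all of [U], not merely on [M], so that these identities can be differentiated in every
    direction. *)
Lemma chart_tproj_facts y : U y ->
  [/\ \det (gram y) != 0, (chart_tproj y)^T = chart_tproj y,
      chart_tproj y *m chart_tproj y = chart_tproj y,
      normal_mx y *m chart_tproj y = 0 &
      forall v : 'cV[R]_n, normal_mx y *m v = 0 -> chart_tproj y *m v = v].
Proof.
move=> Uy.
have EN : (pid_mx d : 'M[R]_n) *m normal_mx y = 0.
  by apply/matrixP => i j; rewrite pid_mx_mulE !mxE; case: (i < d)%N.
have NE0 (v : 'cV[R]_n) : (normal_mx y)^T *m v = 0 ->
    (pid_mx d : 'M[R]_n) *m v = 0 -> v = 0.
  move=> Nv Ev.
  (* The Jacobian matrix of [phi], invertible because [psi] inverts [phi]. When the first [d]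
     entries of [v] vanish, the rows erased in [normal_mx] do not contribute, so
     [A^T v = N^T v = 0]. *)
  pose A : 'M[R]_n := \matrix_(i, j) ('d phi y (delta_mx j 0)) i 0.
  have uA : A \in unitmx.
    apply: unitmx_ker0 => w Aw.
    suff e : 'd phi y w = 0.
      have l0 : 'd psi (phi y) 0 = 0 by exact: linear0.
      exact: etrans (esym (chart_diffK w Uy)) (etrans (congr1 ('d psi (phi y)) e) l0).
    rewrite -Aw; apply/colP => i; rewrite -diff_phi_i // phi_iE mxE.
    by apply: eq_bigr => j _; rewrite mxE diff_phi_i // mulrC.
  have : A^T *m v = 0.
    rewrite -Nv; apply/colP => j; rewrite !mxE; apply: eq_bigr => i _.
    rewrite !mxE; case: ifP => id; last by rewrite diff_phi_i.
    by have /colP/(_ i) := Ev; rewrite pid_mx_mulE id mxE => ->; rewrite !mulr0.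
  by move/(congr1 (mulmx (invmx A^T))); rewrite mulKmx ?unitmx_tr // mulmx0.
have [] := kernel_projector _ _ EN NE0; rewrite ?tr_pid_mx ?pid_mx_id //.
rewrite -/(gram y) => uG; have dG : \det (gram y) != 0.
  by move: uG; rewrite unitmxE unitfE.
have -> : 1%:M - (normal_mx y)^T *m invmx (gram y) *m normal_mx y = chart_tproj y.
  by rewrite /invmx uG.
by split.
Qed.

Lemma Cr_on_normal_mx r : Cr_mx r U normal_mx.
Proof.
move=> i j; under eq_fun do rewrite mxE.
case: (i < d)%N; first exact: Cr_on_cst.
have [_ h] := sphi r.+1.
apply: (Cr_on_ext oU _ (Cr_on_entry i 0 oU (h (delta_mx j 0)))) => y Uy.
by rewrite diff_phi_i.
Qed.

Lemma Cr_on_chart_tproj r : Cr_mx r U chart_tproj.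
Proof.
have alg := fun_algebra_Cr_on r oU; have hN := Cr_on_normal_mx r.
have hG : Cr_mx r U gram.
  apply: (in_algebra_add alg) (in_algebra_cst alg _).
  by apply: (in_algebra_mul alg) => //; exact: in_algebra_tr.
apply: (in_algebra_add alg (in_algebra_cst alg _)).
apply: in_algebra_opp => //; apply: in_algebra_mul => //.
apply: in_algebra_mul => //; first exact: in_algebra_tr.
apply: in_algebra_scale => //; last exact: in_algebra_adj.
apply: Cr_on_inv => //; last exact: algebra_det.
by move=> y Uy; have [] := chart_tproj_facts Uy.
Qed.

End chart.

Lemma Cr_mx_differentiable {R : realType} {V : normedModType R} {m n} (U : set V)
    (A : V -> 'M[R]_(m, n)) y : (forall r, Cr_mx r U A) -> U y -> mx_differentiable A y.
Proof. by move=> hA Uy i j; have [h _] := hA 1 i j; exact: h. Qed.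

Lemma diff2_sum {R : realType} {n} (U : set 'cV[R]_n) (g : 'cV[R]_n -> R) y (u v : 'cV[R]_n) :
  open U -> Cr_on 2 U g -> U y ->
  \sum_j v j 0 * 'd (fun z => 'd g z (delta_mx j 0)) y u =
  'd (fun z => 'd g z u) y v.
Proof.
move=> oU g2 Uy; rewrite [RHS]linear_cV; apply: eq_bigr => j _.
exact: (congr1 ( *%R (v j 0)) (diff2_sym oU g2 (delta_mx j 0) u Uy)).
Qed.

Lemma Cr_on_sub {R : realType} {V W : normedModType R} r (U U' : set V) (g : V -> W) :
  U' `<=` U -> Cr_on r U g -> Cr_on r U' g.
Proof.
move=> UU; elim: r g => [|r IH] g /=; first by move=> cg x /UU; exact: cg.
by move=> [dg hg]; split=> [x /UU|v]; [exact: dg|exact: IH].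
Qed.

Lemma dmx_eq0 {R : realType} {V : normedModType R} {m n} (U : set V)
    (A : V -> 'M[R]_(m, n)) y u :
  open U -> U y -> (forall z, U z -> A z = 0) -> dmx A y u = 0.
Proof.
move=> oU Uy A0; rewrite -(@near_eq_dmx _ _ _ _ (fun=> 0) A).
- by apply/matrixP => i j; rewrite !mxE diff_cst.
- by move=> i j; exact: differentiable_cst.
- by apply: filterS (open_nbhs_nbhs (conj oU Uy)) => z /A0.
Qed.

(** Differentiating [T T = T] gives [T' = T' T + T T']; multiplied by [T] on both sides this reads
    [T T' T = 2 T T' T]. It expresses that the second fundamental form is normal. *)
Lemma idempotent_dmx {R : realType} {V : normedModType R} {n} (U : set V)
    (T : V -> 'M[R]_n) y u : open U -> U y -> mx_differentiable T y ->
  (forall z, U z -> T z *m T z = T z) -> T y *m dmx T y u *m T y = 0.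
Proof.
move=> oU Uy dT TT.
have e : dmx T y u = dmx T y u *m T y + T y *m dmx T y u.
  rewrite -(dmx_mul u dT dT); apply: (near_eq_dmx u dT).
  by apply: filterS (open_nbhs_nbhs (conj oU Uy)) => z /TT.
apply: (addrI (T y *m dmx T y u *m T y)); rewrite addr0 {3}e mulmxDr mulmxDl.
by rewrite !mulmxA (TT y Uy) -[_ *m T y *m T y]mulmxA (TT y Uy).
Qed.

Section chart_tangent.
Context {R : realType} {n : nat}.
Variables (d : nat) (M U : set 'cV[R]_n) (phi psi : 'cV[R]_n -> 'cV[R]_n).
Hypothesis dn : (d <= n)%N.
Hypotheses (oU : open U) (sphi : smooth_on U phi).
Hypotheses (oV : open (phi @` U)) (spsi : smooth_on (phi @` U) psi).
Hypothesis psiK : forall y, U y -> psi (phi y) = y.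
Hypothesis Mphi : forall y, U y ->
  (M y <-> forall i : 'I_n, (d <= i)%N -> phi y i 0 = 0).

Local Notation N := (normal_mx d phi).
Local Notation T := (chart_tproj d phi).

(** The defining functions vanish along a curve of [M], which gives one direction. Conversely the
    line from [phi y] with velocity ['d phi y u] stays in the coordinate subspace, and [psi] carries
    it to a curve of [M]. *)
Lemma chart_tangentP y u : U y -> M y -> (tangent M y u <-> N y *m u = 0).
Proof.
move=> Uy My; have dphi : differentiable phi y by have [h _] := sphi 1; exact: h.
split.
  move=> [c hc]; have [_ c0 dc] := hc.
  apply/colP => i; rewrite (normal_mxE d sphi) // mxE; case: ltnP => // di.
  have [d1 d2] := diff_entry u i 0 dphi.
  rewrite -d2; rewrite -c0 in d1 *.
  have [_ <-] := is_derive_comp_diff (h := fun z => phi z i 0 : R) dc d1.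
  have : is_derive (0 : R) (1 : R) ((fun z => phi z i 0 : R) \o c) 0.
    apply: near_eq_is_derive (is_derive_cst (0 : R) (0 : R) (1 : R)).
    apply: filterS (curve_through_near hc oU Uy) => t [Ut Mt] /=.
    by rewrite ((Mphi Ut).1 Mt).
  by case.
move=> Nu; pose w := 'd phi y u.
have w0 (i : 'I_n) : (d <= i)%N -> w i 0 = 0.
  move=> di; have /colP/(_ i) := Nu; rewrite (normal_mxE d sphi) // mxE.
  by rewrite ltnNge di.
have dpsi : differentiable psi (phi y).
  by have [h _] := spsi 1; apply: h; exists y.
have dl := is_derive_line (phi y) w (0 : R).
have cl : {for (0 : R), continuous (fun s : R => phi y + s *: w)}.
  by apply/differentiable_continuous/derivable1_diffP; case: dl.
have /nbhs_ballP[e /= e0 he] : \forall s \near (0 : R), (phi @` U) (phi y + s *: w).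
  by apply: cl; rewrite scale0r addr0; apply: open_nbhs_nbhs; split => //; exists y.
exists (fun t : R => psi (phi y + t *: w)); split.
- exists e => //; split=> [r|t te].
    by apply: Cr_on_line (spsi r); [exact: ball_open|exact: he].
  have [z Uz zE] := he t te; rewrite -zE psiK //.
  apply/(Mphi Uz) => i di; rewrite zE !mxE w0 // mulr0 addr0.
  exact: (Mphi Uy).1.
- by rewrite scale0r addr0 psiK.
- have := is_derive_comp_diff (h := psi) dl.
  by rewrite scale0r addr0 (chart_diffK oU sphi spsi psiK) //; apply.
Qed.

Lemma dnormal_mx_sym y u v : U y -> dmx N y u *m v = dmx N y v *m u.
Proof.
move=> Uy.
suff e a b : dmx N y a *m b = \col_i if (i < d)%N then 0 else
    'd (fun z => 'd (fun z => phi z i 0 : R) z a) y b.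
  rewrite !e; apply/colP => i; rewrite !mxE; case: ifP => // _.
  by apply: (diff2_sym oU) => //; exact: Cr_on_entry.
apply/colP => i; rewrite !mxE; case: ifP => id.
  rewrite big1 // => j _; rewrite mxE.
  have -> : (fun z => N z i j) = cst 0 by apply/funext => z; rewrite mxE id.
  by rewrite diff_cst mul0r.
rewrite -(diff2_sum _ _ oU (Cr_on_entry i 0 oU (sphi 2)) Uy).
apply: eq_bigr => j _; rewrite mxE mulrC.
have -> : (fun z => N z i j) =
    (fun z => 'd (fun z => phi z i 0 : R) z (delta_mx j 0)) => //.
by apply/funext => z; rewrite mxE id.
Qed.

Lemma chart_tproj_orth y : U y -> M y -> orth_projector (tangent M y) (T y).
Proof.
move=> Uy My; have [_ TT TK NT hT] := chart_tproj_facts dn oU sphi spsi psiK Uy.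
split => //; apply/seteqP; split=> u.
  by move=> [v _ <-]; apply/chart_tangentP => //; rewrite mulmxA NT mul0mx.
by move=> /(chart_tangentP u Uy My)/hT <-; exists u.
Qed.

(** Symmetry of the second fundamental form. Differentiating [N T = 0] gives
    [N (dT u v) = - dN u v], symmetric in [u] and [v]; so [N] kills the difference of the two sides
    and [T] fixes it. But [T] also kills each side, by [idempotent_dmx]. *)
Lemma dchart_tproj_sym y u v : U y -> M y -> tangent M y u -> tangent M y v ->
  dmx T y u *m v = dmx T y v *m u.
Proof.
move=> Uy My /(chart_tangentP u Uy My) Nu /(chart_tangentP v Uy My) Nv.
have hU z := @chart_tproj_facts _ _ _ _ _ _ dn oU sphi spsi psiK z.
have [_ _ _ _ hT] := hU y Uy.
have dN : mx_differentiable N y by apply: Cr_mx_differentiable Uy => r; exact: Cr_on_normal_mx.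
have dT : mx_differentiable T y by apply: Cr_mx_differentiable Uy => r; exact: (Cr_on_chart_tproj dn oU sphi spsi psiK).
have NdT (a b : 'cV[R]_n) : N y *m b = 0 -> N y *m (dmx T y a *m b) = - (dmx N y a *m b).
  move=> Nb; have : dmx (fun z => N z *m T z) y a = 0.
    by apply: dmx_eq0 oU Uy _ => z /hU[].
  rewrite dmx_mul // => /(congr1 (mulmx^~ b)).
  rewrite mul0mx mulmxDl -(mulmxA (dmx N y a)) -(mulmxA (N y)) (hT b Nb).
  by move=> /eqP; rewrite addrC addr_eq0 => /eqP.
have TdT (a b : 'cV[R]_n) : N y *m b = 0 -> T y *m (dmx T y a *m b) = 0.
  move=> Nb; rewrite -[in LHS](hT b Nb) !mulmxA.
  rewrite (idempotent_dmx a oU Uy dT) ?mul0mx // => z.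
  by case/hU.
apply/eqP; rewrite -subr_eq0; apply/eqP.
rewrite -[LHS]hT; first by rewrite mulmxBr !TdT // subrr.
by rewrite mulmxBr !NdT // dnormal_mx_sym // subrr.
Qed.

End chart_tangent.

(** Interface to the charts: the rest of the proof uses the slice condition only through the smooth
    extension [T]. *)
Lemma local_tproj {R : realType} {n d} (M : set 'cV[R]_n) x :
  embedded_submanifold d M -> M x ->
  exists (U : set 'cV[R]_n) (T : 'cV[R]_n -> 'M[R]_n),
    [/\ open U /\ U x,
      forall r, Cr_mx r U T,
      forall y, U y -> (T y)^T = T y /\ T y *m T y = T y,
      forall y, U y -> M y -> orth_projector (tangent M y) (T y) &
      forall y u v, U y -> M y -> tangent M y u -> tangent M y v ->
        dmx T y u *m v = dmx T y v *m u].
Proof.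
move=> [dn hM] /hM[U [phi [psi [[oU Ux] sphi [oV spsi] psiK Mphi]]]].
exists U, (chart_tproj d phi); split.
- by [].
- by move=> r; exact: (Cr_on_chart_tproj dn oU sphi spsi psiK).
- by move=> y Uy; have [_ ? ? _ _] := chart_tproj_facts dn oU sphi spsi psiK Uy.
- by move=> y; exact: (chart_tproj_orth dn oU sphi oV spsi psiK Mphi).
- by move=> y u v; exact: (dchart_tproj_sym dn oU sphi oV spsi psiK Mphi).
Qed.

Definition egrad {R : realType} {n} (f : 'cV[R]_n -> R) (y : 'cV[R]_n) : 'cV[R]_n :=
  \col_j 'd f y (delta_mx j 0).

Definition jac {R : realType} {n m} (g : 'cV[R]_n -> 'cV[R]_m) (y : 'cV[R]_n) :
  'M[R]_(m, n) := \matrix_(i, j) 'd (fun z => g z i 0 : R) y (delta_mx j 0).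

Lemma jacE {R : realType} {n m} (g : 'cV[R]_n -> 'cV[R]_m) y u : dmx g y u = jac g y *m u.
Proof.
apply/colP => i; rewrite !mxE linear_cV; apply: eq_bigr => j _.
by rewrite mxE mulrC.
Qed.

Lemma dmx_linear {R : realType} {n m p} (A : 'cV[R]_n -> 'M[R]_(m, p)) y u :
  dmx A y u = \sum_l u l 0 *: dmx A y (delta_mx l 0).
Proof.
apply/matrixP => i j; rewrite mxE summxE linear_cV; apply: eq_bigr => l _.
by rewrite !mxE.
Qed.

Lemma egrad_dot {R : realType} {n} (f : 'cV[R]_n -> R) y (v : 'cV[R]_n) :
  dot (egrad f y) v = 'd f y v.
Proof.
rewrite dotE linear_cV; apply: eq_bigr => i _.
by rewrite mxE mulrC.
Qed.

(** * Gradient, Hessian and second fundamental form through the extended projector *)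

Section local_formulas.
Context {R : realType} {n : nat}.
Variables (M U : set 'cV[R]_n) (T : 'cV[R]_n -> 'M[R]_n) (f : 'cV[R]_n -> R).
Hypothesis oU : open U.
Hypothesis hT : forall r, Cr_mx r U T.
Hypothesis T_proj : forall y, U y -> (T y)^T = T y /\ T y *m T y = T y.
Hypothesis Torth : forall y, U y -> M y -> orth_projector (tangent M y) (T y).
Hypothesis Tsym : forall y u v, U y -> M y -> tangent M y u -> tangent M y v ->
  dmx T y u *m v = dmx T y v *m u.
Hypothesis hf : smooth_on [set: 'cV[R]_n] f.

Let TT y : U y -> T y *m T y = T y. Proof. by case/T_proj. Qed.

Let grad_T y := T y *m egrad f y.

Lemma tproj_eq y : U y -> M y -> tproj M y = T y.
Proof.
move=> Uy My; apply: (@orth_projector_uniq _ _ (tangent M y)); last exact: Torth.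
by rewrite /tproj; set S := (X in get X); apply: (@getPex _ S); exists (T y); exact: Torth.
Qed.

Lemma tangentP y u : U y -> M y -> (tangent M y u <-> T y *m u = u).
Proof.
move=> Uy My; have [_ _ <-] := Torth Uy My; split=> [[v _ <-]|Tu].
  by rewrite mulmxA TT.
by exists u.
Qed.

Lemma tangent_T y u : U y -> M y -> tangent M y (T y *m u).
Proof. by move=> Uy My; apply/tangentP => //; rewrite mulmxA TT. Qed.

Let T_tr y : U y -> (T y)^T = T y. Proof. by case/T_proj. Qed.

Let f_diff y : differentiable f y.
Proof. by have [h _] := hf 1; exact: h. Qed.

Lemma Cr_on_egrad r : Cr_mx r U (egrad f).
Proof.
move=> i j; under eq_fun do rewrite mxE.
by apply: (@Cr_on_sub _ _ _ _ [set: _]) => //; have [_ h] := hf r.+1; exact: h.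
Qed.

Lemma Cr_on_grad_T r : Cr_mx r U grad_T.
Proof.
apply: (in_algebra_mul (fun_algebra_Cr_on r oU)); first exact: hT.
exact: Cr_on_egrad.
Qed.

Lemma rgrad_eq y : U y -> M y -> rgrad M f y = T y *m egrad f y.
Proof.
move=> Uy My.
have dfE v : tangent M y v -> mdiff M f y v = 'd f y v.
  move=> tv; apply: mdiff_eq => // c [_ c0 dc].
  by rewrite -c0; apply: is_derive_comp_diff => //; exact: f_diff.
rewrite /rgrad; set S := (X in get X).
have ST : S (T y *m egrad f y).
  split; first exact: tangent_T.
  move=> v tv; rewrite dfE // dot_mull T_tr // ((tangentP v Uy My).1 tv).
  exact: egrad_dot.
have [t1 h1] : S (get S) by apply: getPex; exists (T y *m egrad f y).
have [t2 h2] := ST; apply/eqP; rewrite -subr_eq0; apply/eqP/dot_eq0.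
have tB : tangent M y (get S - T y *m egrad f y).
  apply/tangentP => //; rewrite mulmxBr.
  by rewrite ((tangentP _ Uy My).1 t1) ((tangentP _ Uy My).1 t2).
by rewrite dotBl h1 // h2 // subrr.
Qed.

Lemma mdiff_tproj y u : U y -> M y -> tangent M y u ->
  mdiff M (tproj M) y u = dmx T y u.
Proof.
move=> Uy My tu; apply: (mdiff_mx oU Uy) tu; first by move=> *; exact: tproj_eq.
exact: Cr_mx_differentiable Uy.
Qed.

Lemma mdiff_rgrad y u : U y -> M y -> tangent M y u ->
  mdiff M (rgrad M f) y u = jac grad_T y *m u.
Proof.
move=> Uy My tu; rewrite -jacE; apply: (mdiff_mx oU Uy) tu.
  by move=> *; exact: rgrad_eq.
by apply: Cr_mx_differentiable Uy; exact: Cr_on_grad_T.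
Qed.

Lemma rhess_eq y : U y -> M y ->
  rhess M f y = T y *m jac grad_T y *m T y.
Proof.
move=> Uy My; apply/matrixP => i j.
rewrite mxE /rhess_op tproj_eq // mdiff_rgrad //; last exact: tangent_T.
by rewrite !mulmxA -colE mxE.
Qed.

Lemma tproj_dmx_tproj y u : U y -> M y -> T y *m dmx T y u *m T y = 0.
Proof.
by move=> Uy My; apply: (idempotent_dmx u oU Uy) TT; exact: Cr_mx_differentiable Uy.
Qed.

(** Let [J] be the Jacobian of [T grad f]. For [b] tangent, [<b, J a> = <dT a b, grad f> + D^2 f (a,
    b)]. The first term is symmetric on tangent vectors by [Tsym], the second by Schwarz, and the
    outer factors [T] leave only tangent vectors to test. *)
Lemma rhess_sym y : U y -> M y -> (rhess M f y)^T = rhess M f y.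
Proof.
move=> Uy My; rewrite rhess_eq //.
have dT : mx_differentiable T y by exact: Cr_mx_differentiable Uy.
have dg : mx_differentiable (egrad f) y by apply: Cr_mx_differentiable Uy => r; exact: Cr_on_egrad.
have dT_tr a : (dmx T y a)^T = dmx T y a.
  rewrite -dmx_tr; apply: near_eq_dmx; first exact: (in_algebra_tr (A := T)).
  by apply: filterS (open_nbhs_nbhs (conj oU Uy)) => z /T_tr.
have key u v : tangent M y u -> tangent M y v ->
    dot v (jac grad_T y *m u) = dot u (jac grad_T y *m v).
  move=> tu tv; have Tu := (tangentP u Uy My).1 tu; have Tv := (tangentP v Uy My).1 tv.
  suff e a b : T y *m b = b -> dot b (jac grad_T y *m a) =
      dot (dmx T y a *m b) (egrad f y) + 'd (fun z => 'd f z a) y b.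
    rewrite !e // (Tsym Uy My tu tv); congr (_ + _).
    exact: (diff2_sym openT (hf 2)).
  move=> Tb; rewrite -jacE dmx_mul // dotC dotDl; congr (_ + _).
    by rewrite dotC dot_mull dT_tr.
  rewrite dot_mull T_tr // Tb dotC dotE -(diff2_sum a b openT (hf 2)) //.
  apply: eq_bigr => j _; rewrite mxE; congr (_ * _).
  have -> : (fun z => egrad f z j 0) = (fun z => 'd f z (delta_mx j 0)) => //.
  by apply/funext => z; rewrite mxE.
have dTJT a b : dot a (T y *m jac grad_T y *m T y *m b) =
    dot b (T y *m jac grad_T y *m T y *m a).
  have e (u v : 'cV[R]_n) : dot u (T y *m jac grad_T y *m T y *m v) =
      dot (T y *m u) (jac grad_T y *m (T y *m v)).
    by rewrite -!mulmxA dotC dot_mull T_tr // dotC.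
  by rewrite !e key //; exact: tangent_T.
apply/matrixP => i j; rewrite mxE.
have E (H : 'M[R]_n) k l : H k l = dot (delta_mx k 0) (H *m delta_mx l 0).
  by rewrite /dot trmx_delta -colE -rowE !mxE.
by rewrite !E dTJT.
Qed.

End local_formulas.

(** * The saddle dynamic on the Grassmann bundle *)

Lemma is_derive_mx_differentiable {R : realType} {m n} (A : R -> 'M[R]_(m, n)) t W :
  is_derive t (1 : R) A W -> mx_differentiable A t /\ dmx A t 1 = W.
Proof.
move=> dA; have dAij i j := is_derive_mx_entry i j dA.
have df i j : differentiable (fun s => A s i j : R) t.
  by apply/derivable1_diffP; case: (dAij i j).
split; first exact: df.
by apply/matrixP => i j; rewrite mxE -deriveE //; case: (dAij i j).
Qed.

Lemma mx_differentiable_is_derive {R : realType} {m n} (A : R -> 'M[R]_(m, n)) t :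
  mx_differentiable A t -> is_derive t (1 : R) A (dmx A t 1).
Proof.
move=> dA; apply: is_derive_mx => i j; rewrite mxE -deriveE; last exact: dA.
by apply: derivableP; apply/derivable1_diffP; exact: dA.
Qed.

(* [B^T B] can be invertible on the range of [P] only; adding [1 - P] gives a Gram
   matrix with an inverse [X]. *)
Lemma projector_of_frame {R : realType} {n} (B P X : 'M[R]_n) :
  P^T = P -> P *m P = P -> B *m P = B ->
  (B^T *m B + (1%:M - P)) *m X = 1%:M ->
  let Q := B *m X *m B^T in
  [/\ Q^T = Q, Q *m Q = Q, \rank Q = \rank P & Q *m B = B].
Proof.
move=> PT PP BP; set G := (X in X *m _) => GX Q.
have [uG XE] : G \in unitmx /\ X = invmx G.
  by have [uG _] := mulmx1_unit GX; split=> //; rewrite -[RHS]mulmx1 -GX mulKmx.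
have GT : G^T = G by rewrite linearD /= trmx_mul trmxK linearB /= trmx1 PT.
have XT : X^T = X by rewrite XE trmx_inv GT.
have PBT : P *m B^T = B^T by rewrite -[in LHS]PT -trmx_mul BP.
have PG : P *m G = B^T *m B by rewrite mulmxDr mulmxA PBT mulmxBr mulmx1 PP subrr addr0.
have GP : G *m P = B^T *m B by rewrite mulmxDl -mulmxA BP mulmxBl mul1mx PP subrr addr0.
have XG : X *m G = 1%:M by rewrite XE mulVmx.
have QB : Q *m B = B.
  rewrite -mulmxA -GP -mulmxA (mulmxA X) XG mul1mx; exact: BP.
have QT : Q^T = Q by rewrite !trmx_mul trmxK XT mulmxA.
split => //; first by rewrite {2}/Q !mulmxA QB.
apply/eqP; rewrite eqn_leq; apply/andP; split.
  rewrite /Q -mulmxA; apply: leq_trans (mxrankM_maxl _ _) _.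
  by rewrite -BP mxrankM_maxr.
(* [P G = B^T B] with [G] invertible, while [B = Q B] bounds the rank of [B^T B] by that of [Q]. *)
have -> : \rank P = \rank (B^T *m B).
  by rewrite -PG mxrankMfree // row_free_unit.
by apply: leq_trans (mxrankM_maxr _ _) _; rewrite -QB mxrankM_maxl.
Qed.

Section bundle.
Context {R : realType} {n : nat}.
Variables (d k : nat) (M : set 'cV[R]_n).
Hypothesis hM : embedded_submanifold d M.

Lemma bundle_tproj x P (T : 'M[R]_n) : orth_projector (tangent M x) T ->
  grassmann_bundle k M (x, P) -> T *m P = P.
Proof.
move=> [_ TT TS] [_ [_ _ _ /= hP]]; apply/matrixP => i j.
have : tangent M x (P *m delta_mx j 0) by apply: hP; exists (delta_mx j 0).
rewrite -TS => -[v _ vE].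
have : col j (T *m P) = col j P by rewrite !colE -mulmxA -vE mulmxA TT.
by move=> /colP/(_ i); rewrite !mxE.
Qed.

(** Each sum over an orthonormal family collapses by linearity to a product with [P], the sum of the
    [q l (q l)^T]; hence the value chosen by [get] is the same for every family. *)
Lemma sff_hatE x u P : grassmann_bundle k M (x, P) ->
  sff_hat k M x u P =
  mdiff M (tproj M) x u *m P + P *m (mdiff M (tproj M) x u)^T.
Proof.
move=> [_ [/= PT PP rP hP]]; rewrite /sff_hat; set S := (X in get X).
set D := mdiff M (tproj M) x u.
have SE Z : S Z -> Z = D *m P + P *m D^T.
  move=> [q [_ _ PE ->]]; rewrite PE mulmx_sumr mulmx_suml; congr (_ + _).
    by apply: eq_bigr => l _; rewrite mulmxA.
  by apply: eq_bigr => l _; rewrite trmx_mul mulmxA.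
have [q [qq PE]] := projector_orthonormal PT PP rP.
apply: SE; apply: (@getPex _ S).
exists (\sum_(l < k) sff M x u (q l) *m (q l)^T +
        \sum_(l < k) q l *m (sff M x u (q l))^T), q; split => // l.
by apply: hP; exists (q l) => //; rewrite PE sum_projector_mul.
Qed.

Lemma bundle_curve x P u H : grassmann_bundle k M (x, P) -> tangent M x u ->
  H^T = H -> tproj M x *m H = H ->
  exists (c : R -> 'cV[R]_n) (Q : R -> 'M[R]_n),
  [/\ c 0 = x /\ Q 0 = P, is_derive (0 : R) (1 : R) c u,
      is_derive (0 : R) (1 : R) Q
        (- commutator P (commutator P H) + sff_hat k M x u P) &
      \forall t \near (0 : R), grassmann_bundle k M (c t, Q t)].
Proof.
move=> hP [c hc] HT PH; have [_ c0 dc] := hc.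
have [Mx [/= PT PP rP _]] := hP.
have [U [T [[oU Ux] hT T_proj Torth Tsym]]] := local_tproj hM Mx.
have tE y : U y -> M y -> tproj M y = T y by move=> Uy; exact: (tproj_eq Torth Uy).
have dT : mx_differentiable T x by exact: Cr_mx_differentiable Ux.
pose S := dmx T x u.
have tu : tangent M x u by exists c.
have SE : mdiff M (tproj M) x u = S by exact: (mdiff_tproj oU hT Torth Ux Mx).
have [dPi PiE] := is_derive_mx_differentiable (is_derive_mdiff_mx oU Ux tE dT hc).
rewrite -/S in PiE.
pose Pi t := tproj M (c t).
have Pi0 : Pi 0 = T x by rewrite /Pi c0 tE.
have TP : T x *m P = P by exact: bundle_tproj (Torth x Ux Mx) hP.
have PTx : P *m T x = P.
  by have [Tt _] := T_proj x Ux; rewrite -[LHS]trmxK trmx_mul Tt PT TP.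
have TST : T x *m S *m T x = 0 by exact: (tproj_dmx_tproj oU hT T_proj).
have PSP : P *m S *m P = 0.
  by rewrite -{1}PTx -{2}TP -!mulmxA (mulmxA S) (mulmxA (T x)) (mulmxA (T x)) TST mul0mx mulmx0.
have TH : T x *m H = H by rewrite -tE.
pose L t : 'M[R]_n := 1%:M - t *: H.
pose B t := Pi t *m L t *m P.
(* At [t = 0] this completed Gram matrix is the identity, so its determinant stays nonzero and [X]
   is its inverse for small [t]. *)
pose G t := (B t)^T *m B t + (1%:M - P).
pose X t := (\det (G t))^-1 *: \adj (G t).
pose Q t := B t *m X t *m (B t)^T.
have B0 : B 0 = P by rewrite /B /L Pi0 scale0r subr0 mulmx1.
have G0 : G 0 = 1%:M by rewrite /G B0 PT PP addrC subrK.
have X0 : X 0 = 1%:M by rewrite /X G0 det1 invr1 scale1r adj1.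
have alg := fun_algebra_differentiable (0 : R).
have dL : is_derive (0 : R) (1 : R) L (- H).
  have -> : L = (fun t => 1%:M + t *: (- H)).
    by apply/funext => t; rewrite /L scalerN.
  exact: is_derive_line.
have [dfL dmL] := is_derive_mx_differentiable dL.
have dfcst (A : 'M[R]_n) : mx_differentiable (fun _ : R => A) 0 by exact: (in_algebra_cst alg).
have dmcst (A : 'M[R]_n) : dmx (fun _ : R => A) 0 1 = 0.
  by apply/matrixP => i j; rewrite !mxE diff_cst.
have dfPL : mx_differentiable (fun t => Pi t *m L t) 0 by exact: (in_algebra_mul alg).
have dfB : mx_differentiable B 0 by exact: (in_algebra_mul alg).
have dfBT : mx_differentiable (fun t => (B t)^T) 0 by exact: (in_algebra_tr dfB).
have dfBB : mx_differentiable (fun t => (B t)^T *m B t) 0 by exact: (in_algebra_mul alg).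
have dfG : mx_differentiable G 0 by exact: (in_algebra_add alg).
have detG : {for (0 : R), continuous (fun t => \det (G t))}.
  apply: differentiable_continuous; exact: (algebra_det alg).
have dfX : mx_differentiable X 0.
  apply: (in_algebra_scale alg); last exact: (in_algebra_adj alg).
  by apply: differentiableV; [exact: (algebra_det alg)|rewrite G0 det1 oner_neq0].
have dfBX : mx_differentiable (fun t => B t *m X t) 0 by exact: (in_algebra_mul alg).
have dfQ : mx_differentiable Q 0 by exact: (in_algebra_mul alg).
have unitG : \forall t \near (0 : R), \det (G t) != 0.
  have d1 : \det (G t) @[t --> (0 : R)] --> (1 : R) by rewrite -(det1 R n) -G0; exact: detG.
  exact: cvgr_neq0 d1 (oner_neq0 R).
have GX : \forall t \near (0 : R), G t *m X t = 1%:M.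
  apply: filterS unitG => t dG.
  by rewrite /X -scalemxAr mul_mx_adj scale_scalar_mx mulVf.
(* Velocity of the frame at 0: [S] comes from the turning of the tangent space, [- H] from the fibre
   motion, which [T] leaves unchanged. *)
pose B' := S *m P - H *m P.
have dB : dmx B 0 1 = B'.
  rewrite /B dmx_mul // dmcst mulmx0 addr0 dmx_mul // PiE dmL Pi0 /L scale0r subr0.
  by rewrite mulmx1 mulmxN TH mulmxBl.
have dG : dmx G 0 1 = B'^T *m P + P *m B'.
  by rewrite /G dmx_add // dmcst addr0 dmx_mul // dmx_tr dB B0 PT.
have dX : dmx X 0 1 = - (B'^T *m P + P *m B').
  have : dmx (fun t => G t *m X t) 0 1 = 0.
    rewrite (@near_eq_dmx _ _ _ _ _ (fun=> 1%:M)) ?dmcst //.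
    exact: (in_algebra_mul alg).
  by rewrite dmx_mul // G0 X0 mulmx1 mul1mx dG => /eqP; rewrite addrC addr_eq0 => /eqP.
have dQ : dmx Q 0 1 = - commutator P (commutator P H) + sff_hat k M x u P.
  rewrite /Q dmx_mul // dmx_mul // dmx_tr dB dX B0 X0 PT mulmx1.
  rewrite sff_hatE // SE.
  have B'T : B'^T = P *m S^T - P *m H by rewrite linearB /= !trmx_mul PT HT.
  (* Since [P S P = 0], the derivative of the inverse Gram matrix is [2 P H P], exactly what
     completes [- H P - P H] to [- [P, [P, H]]]; the terms in [S] form [sff_hat]. *)
  have PB' : P *m B' = - (P *m H *m P) by rewrite mulmxBr !mulmxA PSP sub0r.
  have PSTP : P *m S^T *m P = 0.
    by apply: trmx_inj; rewrite !trmx_mul trmxK PT mulmxA PSP trmx0.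
  have B'TP : B'^T *m P = - (P *m H *m P) by rewrite B'T mulmxBl PSTP sub0r.
  have B'P : B' *m P = B' by rewrite mulmxBl -!mulmxA PP.
  rewrite PB' B'TP opprD !opprK mulmxDl B'P.
  have -> : P *m (P *m H *m P + P *m H *m P) *m P = P *m H *m P + P *m H *m P.
    by rewrite mulmxDr mulmxDl !mulmxA PP -[_ *m P *m P]mulmxA PP.
  have -> : P *m 1%:M *m B'^T = P *m S^T - P *m H by rewrite B'T mulmx1 mulmxBr !mulmxA PP.
  have -> : commutator P (commutator P H) = P *m H - P *m H *m P - (P *m H *m P - H *m P).
    by rewrite /commutator mulmxBr mulmxBl !mulmxA PP -(mulmxA H) PP.
  by rewrite /B'; apply/matrixP => i j; rewrite !mxE; ring.
exists c, Q; split => //.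
- by split=> //; rewrite /Q B0 X0 PT mulmx1 PP.
- by rewrite -dQ; exact: mx_differentiable_is_derive.
near=> t.
have [Ut Mt] : U (c t) /\ M (c t) by near: t; exact: curve_through_near hc oU Ux.
have BP : B t *m P = B t by rewrite /B -mulmxA PP.
have GXt : G t *m X t = 1%:M by near: t; exact: GX.
have [QT QQ rQ QB] := projector_of_frame PT PP BP GXt.
split => //=; split => //; first by rewrite rQ.
move=> _ [v _ <-].
have -> : Q t *m v = T (c t) *m (L t *m P *m X t *m (B t)^T *m v).
  by rewrite /Q {1}/B /Pi tE // !mulmxA.
exact: (tangent_T T_proj Torth).
Unshelve. all: by end_near. Qed.

End bundle.

Lemma fun_algebra_continuous {R : realType} {E : normedModType R} (z : E) :
  fun_algebra (fun g : E -> R => {for z, continuous g}).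
Proof.
split; first by move=> c; exact: cst_continuous.
- by move=> f g cf cg; exact: continuousD.
- by move=> f g cf cg; exact: continuousM.
Qed.

Lemma bounded_closed_compact_mx {R : realType} {m n} (A : set 'M[R]_(m, n)) (B : R) :
  (forall a, A a -> `|a| <= B) -> closed A -> compact A.
Proof.
move=> AB cA.
have cv : continuous (vec_mx : 'rV[R]_(m * n) -> 'M[R]_(m, n)).
  apply: (@lipschitz_dist_continuous _ _ _ _ 1) => s t; rewrite mul1r.
  rewrite -linearB; apply: normmx_le => // i j.
  by rewrite mxE; exact: normmx_entry.
have -> : A = vec_mx @` (vec_mx @^-1` A).
  apply/seteqP; split=> [a Aa|_ [v Av <-] //].
  by exists (mxvec a); rewrite /= mxvecK.
apply: continuous_compact; first exact: continuous_subspaceT.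
apply: bounded_closed_compact; last exact: closed_comp (fun v _ => cv v) cA.
exists B; split; first exact: num_real.
move=> b Bb v /AB vB; apply: le_trans (ltW Bb); apply: normmx_le.
  by apply: le_trans vB.
move=> i j; rewrite -[v]vec_mxK ord1; case/mxvec_indexP: j => a b'.
by rewrite mxvecE; apply: le_trans vB; exact: normmx_entry.
Qed.

Lemma closure_zero {R : realType} {E : normedModType R} (K : set E) z (g : E -> R) :
  closure K z -> {for z, continuous g} -> (\near z, K z -> g z = 0) -> g z = 0.
Proof.
move=> cz cg g0; apply/eqP; apply: contrapT => /negP gz.
have gn : \forall w \near z, g w != 0 by exact: cvgr_neq0 cg gz.
have [w [Kw [gw1 gw2]]] := cz _ (filterI g0 gn).
by move: gw2; rewrite gw1 // eqxx.
Qed.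

(** * Compactness of the Grassmann bundle *)

Section bundle_compact.
Context {R : realType} {n : nat}.
Variables (d k : nat) (M : set 'cV[R]_n).
Hypothesis hM : embedded_submanifold d M.
Hypothesis cM : compact M.

Local Notation E := 'M[R]_(n, 1 + n).

Definition bundle_mx : set E :=
  [set z | grassmann_bundle k M (lsubmx z, rsubmx z)].

Lemma normmx_lsub (z : E) : `|lsubmx z| <= `|z|.
Proof. by apply: normmx_le => // i j; rewrite mxE; exact: normmx_entry. Qed.

(** For closedness every fibre condition becomes an equation between functions continuous at the
    limit point: tangency is [T P = P], and the rank of a projector is its trace. *)
Lemma compact_bundle_mx : compact bundle_mx.
Proof.
have [B [_ hB]] := compact_bounded cM.
apply: (@bounded_closed_compact_mx _ _ _ _ (Num.max (B + 1) 1)).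
  move=> z [/= Mx [/= PT PP _ _]]; apply: normmx_le.
    by rewrite le_max ler01 orbT.
  move=> i j; rewrite -[z]hsubmxK mxE le_max; case: splitP => l _.
    apply/orP; left; apply: le_trans (normmx_entry _ _ _) _.
    by apply: (hB (B + 1)) => //; rewrite ltrDl.
  by apply/orP; right; exact: projector_entry_le1.
move=> z cz.
have cls : continuous (lsubmx : E -> 'cV[R]_n) by exact: continuous_lsubmx.
have Mx : M (lsubmx z).
  have cM' : closed M := compact_closed (@norm_hausdorff _ _) cM.
  apply: (closed_comp (fun z _ => cls z) cM'); move: cz; apply: closure_subset.
  by move=> w [].
have [U [T [[oU Ux] hT T_proj Torth Tsym]]] := local_tproj hM Mx.
have alg := fun_algebra_continuous z.
have nU : \forall w \near z, U (lsubmx w).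
  by apply: cls; exact: open_nbhs_nbhs (conj oU Ux).
have cP i j : {for z, continuous (fun w : E => rsubmx w i j)}.
  apply: (@continuous_comp _ _ _ (rsubmx : E -> 'M[R]_n) (fun P => P i j)).
    exact: continuous_rsubmx.
  exact: coord_continuous.
have cT i j : {for z, continuous (fun w : E => T (lsubmx w) i j)}.
  apply: (@continuous_comp _ _ _ (lsubmx : E -> 'cV[R]_n) (fun y => T y i j)).
    exact: cls.
  exact: hT 0%N i j _ Ux.
have zero (g : E -> R) : {for z, continuous g} ->
    (forall w, U (lsubmx w) -> bundle_mx w -> g w = 0) -> g z = 0.
  move=> cg g0; apply: (closure_zero cz cg).
  by apply: filterS nU => w Uw Kw; exact: g0.
have zeromx (A B' : E -> 'M[R]_n) :
    in_algebra (fun g : E -> R => {for z, continuous g}) A ->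
    in_algebra (fun g : E -> R => {for z, continuous g}) B' ->
    (forall w, U (lsubmx w) -> bundle_mx w -> A w = B' w) -> A z = B' z.
  move=> cA cB AB; apply/matrixP => i j; apply/eqP; rewrite -subr_eq0; apply/eqP.
  apply: (zero (fun w => A w i j - B' w i j)).
    by apply: continuousB; [exact: cA|exact: cB].
  by move=> w Uw Kw; rewrite (AB w Uw Kw) subrr.
have PT : (rsubmx z)^T = rsubmx z.
  apply: (zeromx (fun w => (rsubmx w)^T) rsubmx) => //; first exact: in_algebra_tr.
  by move=> w _ [_ []].
have PP : rsubmx z *m rsubmx z = rsubmx z.
  apply: (zeromx (fun w => rsubmx w *m rsubmx w) rsubmx) => //.
    exact: (in_algebra_mul alg).
  by move=> w _ [_ []].
have TP : T (lsubmx z) *m rsubmx z = rsubmx z.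
  apply: (zeromx (fun w => T (lsubmx w) *m rsubmx w) rsubmx) => //.
    exact: (in_algebra_mul alg).
  move=> w Uw Kw; have [Mw _] := Kw.
  exact: bundle_tproj (Torth _ Uw Mw) Kw.
split => //=; split => //=.
  apply/eqP; rewrite -(eqr_nat R) -mxtrace_idempotent // -subr_eq0; apply/eqP.
  apply: (zero (fun w => \tr (rsubmx w) - k%:R)).
    apply: continuousB; last exact: cst_continuous.
    exact: (algebra_sum alg).
  by move=> w _ [_ [/= _ PPw rw _]]; rewrite mxtrace_idempotent // rw subrr.
move=> _ [v _ <-]; apply/(tangentP T_proj Torth _ Ux Mx).
by rewrite mulmxA TP.
Qed.

End bundle_compact.

(** * The saddle vector field *)

Section saddle_field.
Context {R : realType} {n : nat}.
Variables (d k : nat) (M : set 'cV[R]_n) (f : 'cV[R]_n -> R).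
Hypothesis hM : embedded_submanifold d M.
Hypothesis cM : compact M.
Hypothesis hf : smooth_on [set: 'cV[R]_n] f.

Local Notation E := 'M[R]_(n, 1 + n).
Local Notation K := (bundle_mx k M).

Definition velocity (x : 'cV[R]_n) (P : 'M[R]_n) : 'cV[R]_n :=
  - reflection P (rgrad M f x).

Definition projector_velocity (x : 'cV[R]_n) (P : 'M[R]_n) : 'M[R]_n :=
  - commutator P (commutator P (rhess M f x)) + sff_hat k M x (velocity x P) P.

Definition saddle_field (z : E) : E :=
  row_mx (velocity (lsubmx z) (rsubmx z)) (projector_velocity (lsubmx z) (rsubmx z)).

(** Needed because [mdiff] is determined only in tangent directions. *)
Lemma velocity_tangent x P : grassmann_bundle k M (x, P) -> tangent M x (velocity x P).
Proof.
move=> hP; have [Mx _] := hP.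
have [U [T [[oU Ux] hT T_proj Torth _]]] := local_tproj hM Mx.
apply/(tangentP T_proj Torth _ Ux Mx).
have TP := bundle_tproj (Torth x Ux Mx) hP.
rewrite /velocity /reflection (rgrad_eq T_proj Torth hf Ux Mx) mulmxN mulmxBr.
by rewrite -scalemxAr !mulmxA TP (T_proj x Ux).2.
Qed.

Lemma locally_lipschitz_lsubmx z (U : set 'cV[R]_n) (h : 'cV[R]_n -> R) :
  open U -> U (lsubmx z) -> Cr_on 1 U h ->
  locally_lipschitz K z (fun w : E => h (lsubmx w)).
Proof.
move=> oU Uz h1; have [L [e [L0 e0 hL]]] := Cr_on1_lipschitz oU Uz h1.
exists L, e; split => // a b _ _.
rewrite -!ball_normE /= => za zb.
have sub (w : E) : `|z - w| < e -> ball (lsubmx z) e (lsubmx w).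
  rewrite -ball_normE /= => zw; apply: le_lt_trans zw.
  by rewrite -linearB; exact: normmx_lsub.
apply: le_trans (hL _ _ (sub a za) (sub b zb)) _.
by rewrite ler_wpM2l // -linearB; exact: normmx_lsub.
Qed.

Lemma locally_lipschitz_rsubmx z :
  in_algebra (locally_lipschitz K z) (rsubmx : E -> 'M[R]_n).
Proof.
move=> i j; exists 1, 1; split => // a b _ _ _ _; rewrite mul1r.
have -> : rsubmx a i j - rsubmx b i j = (a - b) i (rshift 1 j) by rewrite !mxE.
exact: normmx_entry.
Qed.

(** On the bundle near [z] every ingredient is a polynomial expression in [P] and in smooth
    functions of [x], so the algebra of locally Lipschitz functions applies. *)
Lemma saddle_field_locally_lipschitz z : K z ->
  in_algebra (locally_lipschitz K z) saddle_field.
Proof.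
move=> Kz; have [Mx _] := Kz.
have [U [T [[oU Ux] hT T_proj Torth Tsym]]] := local_tproj hM Mx.
have alg := fun_algebra_locally_lipschitz Kz.
pose g y := T y *m egrad f y.
have hg r : Cr_mx r U g by exact: (Cr_on_grad_T oU hT hf).
have lift m p (A : 'cV[R]_n -> 'M[R]_(m, p)) : Cr_mx 1 U A ->
    in_algebra (locally_lipschitz K z) (fun w : E => A (lsubmx w)).
  by move=> hA i j; exact: (locally_lipschitz_lsubmx oU Ux (hA i j)).
have lP := locally_lipschitz_rsubmx z.
have lT := lift _ _ _ (hT 1%N).
have lg := lift _ _ _ (hg 1%N).
have lJ : in_algebra (locally_lipschitz K z) (fun w : E => jac g (lsubmx w)).
  apply: (lift _ _ (jac g)) => i j; under eq_fun do rewrite mxE.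
  by have [_ h] := hg 2%N i 0; exact: h.
have ldT l : in_algebra (locally_lipschitz K z)
    (fun w : E => dmx T (lsubmx w) (delta_mx l 0)).
  apply: (lift _ _ (fun y => dmx T y (delta_mx l 0))) => i j.
  under eq_fun do rewrite mxE.
  by have [_ h] := hT 2%N i j; exact: h.
pose v (w : E) := - (g (lsubmx w) - 2%:R *: (rsubmx w *m g (lsubmx w))).
pose H (w : E) := T (lsubmx w) *m jac g (lsubmx w) *m T (lsubmx w).
(* The direction of differentiation itself depends on [w], hence the expansion into coordinate
   directions with coefficients [v w l 0]. *)
pose S (w : E) := \sum_l v w l 0 *: dmx T (lsubmx w) (delta_mx l 0).
pose C (w : E) (B : 'M[R]_n) := rsubmx w *m B - B *m rsubmx w.
have lv : in_algebra (locally_lipschitz K z) v.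
  apply: (in_algebra_opp alg); apply: (in_algebra_add alg) => //.
  apply: (in_algebra_opp alg); apply: (in_algebra_scale alg).
    by case: alg => h _ _; exact: h.
  exact: (in_algebra_mul alg).
have lH : in_algebra (locally_lipschitz K z) H.
  by apply: (in_algebra_mul alg) => //; exact: (in_algebra_mul alg).
have lS : in_algebra (locally_lipschitz K z) S.
  apply: (in_algebra_sum alg) => l.
  by apply: (in_algebra_scale alg); [exact: lv|exact: ldT].
have lC B : in_algebra (locally_lipschitz K z) B ->
    in_algebra (locally_lipschitz K z) (fun w => C w (B w)).
  move=> lB; apply: (in_algebra_add alg); first exact: (in_algebra_mul alg).
  by apply: (in_algebra_opp alg); exact: (in_algebra_mul alg).
pose D (w : E) := - C w (C w (H w)) + (S w *m rsubmx w + rsubmx w *m (S w)^T).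
have lD : in_algebra (locally_lipschitz K z) D.
  apply: (in_algebra_add alg).
    by apply: (in_algebra_opp alg); apply: (lC (fun w => C w (H w))); exact: lC.
  apply: (in_algebra_add alg); first exact: (in_algebra_mul alg).
  by apply: (in_algebra_mul alg) => //; exact: in_algebra_tr.
have nU : \forall w \near z, U (lsubmx w).
  have cls : continuous (lsubmx : E -> 'cV[R]_n) by exact: continuous_lsubmx.
  by apply: cls; exact: open_nbhs_nbhs (conj oU Ux).
have fE w : U (lsubmx w) -> K w -> saddle_field w = row_mx (v w) (D w).
  move=> Uw Kw; have [Mw _] := Kw.
  have vE : velocity (lsubmx w) (rsubmx w) = v w.
    by rewrite /velocity (rgrad_eq T_proj Torth hf Uw Mw).
  have tv : tangent M (lsubmx w) (v w) by rewrite -vE; exact: velocity_tangent.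
  rewrite /saddle_field /projector_velocity vE; congr row_mx.
  rewrite (rhess_eq oU hT T_proj Torth hf Uw Mw) (sff_hatE (v w) Kw).
  by rewrite (mdiff_tproj oU hT Torth Uw Mw tv) dmx_linear.
pose W (w : E) : E := row_mx (v w) (D w).
move=> i j; apply: (@locally_lipschitz_ext _ _ _ _ (fun w => W w i j)).
  by apply: filterS nU => w Uw Kw; rewrite fE.
under eq_fun do rewrite /W mxE.
by case: (fintype.split j) => l; [exact: lv|exact: lD].
Qed.

Lemma saddle_field_lipschitz : exists2 L, 0 < L & forall a b, K a -> K b ->
  `|saddle_field a - saddle_field b| <= L * `|a - b|.
Proof.
have cK := compact_bundle_mx (k := k) hM cM.
have /choice[L hL] : forall ij : 'I_n * 'I_(1 + n), exists L : R, 0 < L /\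
    forall a b, K a -> K b ->
    `|saddle_field a ij.1 ij.2 - saddle_field b ij.1 ij.2| <= L * `|a - b|.
  move=> [i j].
  have [L L0 hL] := @compact_locally_lipschitz _ _ K (fun z => saddle_field z i j) cK
    (fun z Kz => saddle_field_locally_lipschitz Kz i j).
  by exists L.
exists (1 + \sum_ij L ij).
  by rewrite ltr_wpDr // sumr_ge0 // => ij _; case: (hL ij) => /ltW.
move=> a b Ka Kb; apply: normmx_le.
  rewrite mulr_ge0 // addr_ge0 // sumr_ge0 // => ij _; by case: (hL ij) => /ltW.
move=> i j; have [_ /(_ a b Ka Kb) h] := hL (i, j).
have entryB (A B : E) : (A - B) i j = A i j - B i j by rewrite !mxE.
rewrite entryB; apply: le_trans h _; rewrite ler_wpM2r //.
rewrite (bigD1 (i, j)) //= addrCA lerDl addr_ge0 // sumr_ge0 // => ij _.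
by case: (hL ij) => /ltW.
Qed.

Lemma saddle_field_curve z : K z -> exists2 c : R -> E, c 0 = z &
  is_derive (0 : R) (1 : R) c (saddle_field z) /\
  exists2 e : R, 0 < e & forall s, 0 <= s < e -> K (c s).
Proof.
move=> Kz; have [Mx _] := Kz.
have [U [T [[oU Ux] hT T_proj Torth Tsym]]] := local_tproj hM Mx.
have HT := rhess_sym oU hT T_proj Torth Tsym hf Ux Mx.
have PH : tproj M (lsubmx z) *m rhess M f (lsubmx z) = rhess M f (lsubmx z).
  rewrite (tproj_eq Torth Ux Mx) (rhess_eq oU hT T_proj Torth hf Ux Mx).
  by rewrite !mulmxA (T_proj _ Ux).2.
have [c [Q [[c0 Q0] dc dQ]]] := bundle_curve hM Kz (velocity_tangent Kz) HT PH.
move=> /nbhs_ballP[e /= e0 he].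
exists (fun t => row_mx (c t) (Q t)); first by rewrite c0 Q0 hsubmxK.
split.
  apply: is_derive_mx => i j; rewrite mxE.
  under eq_fun do rewrite mxE.
  by case: (fintype.split j) => l; exact: is_derive_mx_entry.
exists e => // s /andP[s0 se]; rewrite /bundle_mx /= row_mxKl row_mxKr; apply: he.
by rewrite -ball_normE /= sub0r normrN ger0_norm.
Qed.

End saddle_field.

Lemma is_derive_within_entry {R : realType} {m n} (J : set R)
    (c : R -> 'M[R]_(m, n)) t w :
  is_derive_within J c t w <->
  forall i j, is_derive_within J (fun s => c s i j : R) t (w i j : R).
Proof.
split=> [h i j|h].
  apply/is_derive_withinP => e e0.
  have [r r0 hr] := (is_derive_withinP _ _ _ _).1 h e e0.
  exists r => // s Js st; apply: le_trans (hr s Js st).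
  have -> : c s i j - c t i j - (s - t) *: (w i j : R) =
    (c s - c t - (s - t) *: w) i j by rewrite !mxE.
  exact: normmx_entry.
rewrite /is_derive_within; apply/cvgrPdist_le => e e0.
have : \forall s \near within J t^', forall i j,
    `|w i j - (s - t)^-1 *: (c s i j - c t i j)| <= e.
  apply: filter_forall => i; apply: filter_forall => j.
  exact: (cvgrPdist_le _ _).1 (h i j) _ e0.
apply: filterS => s hs; apply: normmx_le; first exact: ltW.
by move=> i j; have := hs i j; rewrite !mxE.
Qed.

Lemma is_derive_within_row_mx {R : realType} {n m p} (J : set R)
    (x : R -> 'M[R]_(n, m)) (P : R -> 'M[R]_(n, p)) t dx dP :
  is_derive_within J (fun s => row_mx (x s) (P s)) t (row_mx dx dP) <->
  is_derive_within J x t dx /\ is_derive_within J P t dP.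
Proof.
split=> [/is_derive_within_entry h|[hx hP]].
  split; apply/is_derive_within_entry => i j.
    have := h i (lshift p j); rewrite row_mxEl.
    by under eq_fun do rewrite row_mxEl.
  have := h i (rshift m j); rewrite row_mxEr.
  by under eq_fun do rewrite row_mxEr.
apply/is_derive_within_entry => i j; rewrite mxE.
under eq_fun do rewrite mxE.
case: (fintype.split j) => l.
  exact: (is_derive_within_entry _ _ _ _).1 hx i l.
exact: (is_derive_within_entry _ _ _ _).1 hP i l.
Qed.

Unset Implicit Arguments.
Set Strict Implicit.
Set Printing Implicit Defensive.

Theorem theorem1 (R : realType) (n d k : nat) (M : set 'cV[R]_n)
    (f : 'cV[R]_n -> R) (x0 : 'cV[R]_n) (P0 : 'M[R]_n)
    (hM : embedded_submanifold d M) (cM : compact M)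
    (hk : (1 <= k)%N) (hkd : (k < d)%N)
    (hf : smooth_on [set: 'cV[R]_n] f)
    (h0 : grassmann_bundle k M (x0, P0)) :
  exists (x : R -> 'cV[R]_n) (P : R -> 'M[R]_n),
    [/\ x 0 = x0 /\ P 0 = P0,
        saddle_dynamic k M f [set t | 0 <= t] x P,
        forall t, 0 <= t -> grassmann_bundle k M (x t, P t) &
        forall (T : R) (y : R -> 'cV[R]_n) (Q : R -> 'M[R]_n),
          y 0 = x0 -> Q 0 = P0 ->
          saddle_dynamic k M f [set t | 0 <= t < T] y Q ->
          (forall t, 0 <= t < T -> grassmann_bundle k M (y t, Q t)) ->
          forall t, 0 <= t < T -> y t = x t /\ Q t = P t].
Proof.
have [L L0 FL] := saddle_field_lipschitz k hM cM hf.
have Kz0 : bundle_mx k M (row_mx x0 P0) by rewrite /bundle_mx /= row_mxKl row_mxKr.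
have [z zz0 hz] := flow_exists L0 FL (compact_bundle_mx hM cM) Kz0
  (fun z Kz => saddle_field_curve hM hf Kz).
exists (lsubmx \o z), (rsubmx \o z); split.
- by rewrite /= zz0 row_mxKl row_mxKr.
- move=> t /= t0; have [_ dz] := hz t t0.
  have [dx dP] : is_derive_within [set s | 0 <= s] (lsubmx \o z) t
      (velocity M f (lsubmx (z t)) (rsubmx (z t))) /\
      is_derive_within [set s | 0 <= s] (rsubmx \o z) t
      (projector_velocity k M f (lsubmx (z t)) (rsubmx (z t))).
    apply/is_derive_within_row_mx.
    have -> : (fun s => row_mx ((lsubmx \o z) s) ((rsubmx \o z) s)) = z => //.
    by apply/funext => s; rewrite /= hsubmxK.
  by exists (velocity M f (lsubmx (z t)) (rsubmx (z t))),
    (projector_velocity k M f (lsubmx (z t)) (rsubmx (z t))).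
- by move=> t /hz[].
- move=> T y Q y0 Q0 hyQ KyQ t tT.
  (* A competitor on the bundle solves the same equation in [K] on [[0, T)]; the derivative of [z]
     relative to the half-line is restricted to that interval. *)
  have e : row_mx (y t) (Q t) = z t.
    apply: (flow_unique L0 FL (y := fun t => row_mx (y t) (Q t)) (T := T)) => //.
    + by rewrite y0 Q0 zz0.
    + move=> {tT}t tT; split; first by rewrite /bundle_mx /= row_mxKl row_mxKr; exact: KyQ.
      have [dx [dP [hx hP dxE dPE]]] := hyQ t tT.
      have vE : velocity M f (y t) (Q t) = dx by rewrite dxE.
      have pE : projector_velocity k M f (y t) (Q t) = dP.
        by rewrite dPE /projector_velocity vE.
      rewrite /saddle_field row_mxKl row_mxKr vE pE.
      by apply/is_derive_within_row_mx.
    + move=> {tT}t /andP[t0 tT]; have [Kz dz] := hz t t0; split => //.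
      by apply: sub_is_derive_within dz => s /= /andP[].
  by rewrite /= -e row_mxKl row_mxKr.
Qed.
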